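(* Assume the degree-of-misspecification condition (with some $B_0\ge0$), the Lipschitz-Hessian condition, the ETO and IEO consistency conditions, the ETO and IEO regularity conditions, and the smoothness and interchangeability condition (all listed in the context). Let $\delta:=\kappa_0^{ETO}-\kappa_0^{IEO}$, let $\tau_1$ be the smallest eigenvalue of $M_1^{IEO}\nabla_{\theta\theta}v_0(w_{\theta^*})M_1^{IEO}-M_1^{ETO}\nabla_{\theta\theta}v_0(w_{\theta^{KL}})M_1^{ETO}$, and let $\tau_6$ be the largest eigenvalue of $M_1^{ETO}\nabla_{\theta\theta}v_0(w_{\theta^{KL}})M_1^{ETO}$. Suppose that $\tau_1\ge0$ (for instance, this holds when $B_0\le\tau_3/C_{mis}$, with $\tau_3$ and $C_{mis}$ as in the context). Then, with the error terms $D^{ETO}_{n,q}$, $D^{IEO}_{n,q}$, $C^{ETO}_{n,q}$ described in the context, the following holds for any sample size $n\ge1$. Case 1: if $t\le\kappa_0^{IEO}$, then $\mathbb P(R(\hat w^{ETO})\ge t)-\mathbb P(R(\hat w^{IEO})\ge t)=0$. Case 2: if $t>\kappa_0^{IEO}+\frac{\tau_6+\tau_1}{\tau_1}\delta$, then for any $0<\varepsilon<\frac{\tau_1}{\tau_1+\tau_6}(t-\kappa_0^{IEO})-\delta$, $$\mathbb P(R(\hat w^{ETO})\ge t)-\mathbb P(R(\hat w^{IEO})\ge t)\le-\mathbb P\Big(nt-n\kappa_0^{IEO}\le\mathbb G^{IEO}\le\big(1+\tfrac{\tau_1}{\tau_6}\big)(nt-n\kappa_0^{IEO}-n\delta-n\varepsilon)\Big)+D^{ETO}_{n,q}+D^{IEO}_{n,q}+C^{ETO}_{n,q}+E_n^{\delta,\varepsilon},$$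 where $E_n^{\delta,\varepsilon}=\exp\Big(-\frac{n\varepsilon^2}{2\|\nabla_\theta v_0(w_{\theta^{KL}})M_1^{ETO}\|^2}\Big)$ depends on the model misspecification. Particularly, when $\delta=0$, for any $t>\kappa_0^{IEO}$, $$\mathbb P(R(\hat w^{ETO})\ge t)-\mathbb P(R(\hat w^{IEO})\ge t)\le-\mathbb P\Big(nt-n\kappa_0^{IEO}\le\mathbb G^{IEO}\le\big(1+\tfrac{\tau_1}{\tau_6}\big)(nt-n\kappa_0^{IEO})\Big)+D^{ETO}_{n,q}+D^{IEO}_{n,q}.$$ All the error terms $D^{ETO}_{n,q},D^{IEO}_{n,q},C^{ETO}_{n,q},E_n^{\delta,\varepsilon}$ go to $0$ as $n\to\infty$.
   Context: Setup. $\Omega\subset\mathbb R^p$ and $\Theta\subset\mathbb R^q$ are open, $\mathcal Z\subset\mathbb R^d$, $c:\Omega\times\mathcal Z\to\mathbb R$ is a known cost function, $P$ is the (unknown) true distribution of a random vector $z\in\mathcal Z$, and $\{P_\theta:\theta\in\Theta\}$ is a parametric family of distributions on $\mathcal Z$ with densities $p_\theta$; $P$ need not belong to the family. $v_0(w):=\mathbb E_P[c(w,z)]$, $w^*\in\arg\min_{w\in\Omega}v_0(w)$, regret $R(w):=v_0(w)-v_0(w^* )$. For $\theta\in\Theta$, $v(w,\theta):=\mathbb E_{P_\theta}[c(w,z)]$ and $w_\theta\in\arg\min_{w\in\Omega}v(w,\theta)$. The data $z_1,\dots,z_n$ are i.i.d. from $P$. ETO (estimate-then-optimize): $\hat\theta^{ETO}$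 maximizes $\frac1n\sum_{i=1}^n\log p_\theta(z_i)$ over $\Theta$, $\hat w^{ETO}:=w_{\hat\theta^{ETO}}$, $\theta^{KL}:=\arg\max_{\theta\in\Theta}\mathbb E_P[\log p_\theta(z)]$. IEO (integrated estimation-optimization): $\hat\theta^{IEO}$ minimizes $\hat v_0(w_\theta):=\frac1n\sum_{i=1}^n c(w_\theta,z_i)$ over $\Theta$, $\hat w^{IEO}:=w_{\hat\theta^{IEO}}$, $\theta^*:=\arg\min_{\theta\in\Theta}v_0(w_\theta)$. $\kappa_0^{ETO}:=v_0(w_{\theta^{KL}})-v_0(w^* )$, $\kappa_0^{IEO}:=v_0(w_{\theta^*})-v_0(w^* )$. $P^{KL}:=P_{\theta^{KL}}$. Notation. Gradients are row vectors. $\nabla_\theta v_0(w_{\theta'})$, $\nabla_{\theta\theta}v_0(w_{\theta'})$ are the gradient and Hessian of $\theta\mapsto v_0(w_\theta)$ at $\theta'$; similarly for $c(w_{\theta'},z)$ and $\log p_{\theta'}(z)$. For a distribution $Q$, $\nabla_{\theta\theta}v(w_{\theta'},Q)$ is the Hessian of $\theta\mapsto\mathbb E_Q[c(w_\theta,z)]$ at $\theta'$ and $\nabla_{\theta\theta}\mathbb E_Q[\log p_{\theta'}(z)]$ that of $\theta\mapsto\mathbb E_Q[\log p_\theta(z)]$ at $\theta'$ ($Q$ held fixed). $\|\cdot\|$ is the Euclidean/spectral norm; for a random vector $X$, $\|X\|_r:=(\mathbb E\|X\|^r)^{1/r}$. $\mathrm{var}_Q$ is the covariance matrix under $Q$.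 $A\le B$ for symmetric matrices means $B-A$ is positive semidefinite; $(\cdot)^{1/2}$ is the positive semidefinite square root. $Y_0\sim N(0,I_q)$. $M_1^{ETO}:=\big((\nabla_{\theta\theta}\mathbb E_P[\log p_{\theta^{KL}}(z)])^{-1}\mathrm{var}_P(\nabla_\theta\log p_{\theta^{KL}}(z))(\nabla_{\theta\theta}\mathbb E_P[\log p_{\theta^{KL}}(z)])^{-1}\big)^{1/2}$, $M_1^{IEO}:=\big(\nabla_{\theta\theta}v_0(w_{\theta^*})^{-1}\mathrm{var}_P(\nabla_\theta c(w_{\theta^*},z))\nabla_{\theta\theta}v_0(w_{\theta^*})^{-1}\big)^{1/2}$. $\mathbb G^{ETO}:=\frac12Y_0^\top M_1^{ETO}\nabla_{\theta\theta}v_0(w_{\theta^{KL}})M_1^{ETO}Y_0$, $\mathbb G^{IEO}:=\frac12Y_0^\top M_1^{IEO}\nabla_{\theta\theta}v_0(w_{\theta^*})M_1^{IEO}Y_0$. $\tau_3$ and $C_{mis}$. Let $\tilde M_1^{ETO}:=\big((\nabla_{\theta\theta}\mathbb E_{P^{KL}}[\log p_{\theta^{KL}}(z)])^{-1}\mathrm{var}_{P^{KL}}(\nabla_\theta\log p_{\theta^{KL}}(z))(\nabla_{\theta\theta}\mathbb E_{P^{KL}}[\log p_{\theta^{KL}}(z)])^{-1}\big)^{1/2}$ and $\tilde M_1^{IEO}:=\big(\nabla_{\theta\theta}v(w_{\theta^{KL}},P^{KL})^{-1}\mathrm{var}_{P^{KL}}(\nabla_\theta c(w_{\theta^{KL}},z))\nabla_{\theta\theta}v(w_{\theta^{KL}},P^{KL})^{-1}\big)^{1/2}$.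 Let $S:=\tilde M_1^{IEO}\nabla_{\theta\theta}v_0(w_{\theta^*})\tilde M_1^{IEO}-\tilde M_1^{ETO}\nabla_{\theta\theta}v_0(w_{\theta^*})\tilde M_1^{ETO}$ and $\Delta:=\big(M_1^{IEO}\nabla_{\theta\theta}v_0(w_{\theta^*})M_1^{IEO}-M_1^{ETO}\nabla_{\theta\theta}v_0(w_{\theta^{KL}})M_1^{ETO}\big)-S$. $\tau_3$ is the smallest eigenvalue of $S$, and $C_{mis}$ is a problem-dependent constant with $\|\Delta\|\le C_{mis}B_0$. Degree-of-misspecification condition: there exists $B_0\ge0$ such that the following five norms are all $\le B_0$: $\|\nabla_{\theta\theta}\mathbb E_P[\log p_{\theta^{KL}}(z)]-\nabla_{\theta\theta}\mathbb E_{P^{KL}}[\log p_{\theta^{KL}}(z)]\|$; $\|\mathrm{var}_P(\nabla_\theta\log p_{\theta^{KL}}(z))-\mathrm{var}_{P^{KL}}(\nabla_\theta\log p_{\theta^{KL}}(z))\|$; $\|\nabla_{\theta\theta}v_0(w_{\theta^*})-\nabla_{\theta\theta}v(w_{\theta^{KL}},P^{KL})\|$; $\|\mathrm{var}_P(\nabla_\theta c(w_{\theta^*},z))-\mathrm{var}_{P^{KL}}(\nabla_\theta c(w_{\theta^{KL}},z))\|$; $\|\nabla_{\theta\theta}v_0(w_{\theta^*})-\nabla_{\theta\theta}v_0(w_{\theta^{KL}})\|$. Lipschitz-Hessian condition: $\Theta$ is bounded and $\|\nabla_{\theta\theta}v_0(w_{\theta_1})-\nabla_{\theta\theta}v_0(w_{\theta_2})\|\le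 L_1\|\theta_1-\theta_2\|$ for all $\theta_1,\theta_2\in\Theta$. ETO consistency conditions: $\sup_{\theta\in\Theta}|\frac1n\sum_i\log p_\theta(z_i)-\mathbb E_P[\log p_\theta(z)]|\xrightarrow{P}0$; for all $\varepsilon>0$, $\sup_{\theta\in\Theta:\|\theta-\theta^{KL}\|\ge\varepsilon}\mathbb E_P[\log p_\theta(z)]<\mathbb E_P[\log p_{\theta^{KL}}(z)]$. IEO consistency conditions: $\sup_{\theta\in\Theta}|\hat v_0(w_\theta)-v_0(w_\theta)|\xrightarrow{P}0$; for all $\varepsilon>0$, $\inf_{\theta\in\Theta:\|\theta-\theta^*\|\ge\varepsilon}v_0(w_\theta)>v_0(w_{\theta^*})$. ETO regularity conditions: $\log p_\theta(z)$ is twice differentiable in $\theta$, and there are constants $\mu^{ETO},c_1^{ETO},c_2^{ETO},c_4^{ETO},\lambda_1^{ETO},\lambda_2^{ETO}>0$, $c_3^{ETO}\ge0$ and nonnegative functions $K_1,K_2,K_3$ on $\mathcal Z$ with $\|K_1(z)\|_9\le c_1^{ETO}$, $\|K_2(z)\|_4\le c_2^{ETO}$, $\|K_3(z)\|_4\le c_3^{ETO}$ such that for all $\theta\in\Theta$, $z\in\mathcal Z$: $\mathbb E_P[\log p_{\theta^{KL}}(z)]-\mathbb E_P[\log p_\theta(z)]\ge\mu^{ETO}\|\theta-\theta^{KL}\|^2$; $|\log p_\theta(z)-\log p_{\theta^{KL}}(z)|\le K_1(z)\|\theta-\theta^{KL}\|$; $\|\nabla_{\theta\theta}\log p_\theta(z)-\nabla_{\theta\theta}\log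 p_{\theta^{KL}}(z)\|\le K_2(z)\|\theta-\theta^{KL}\|$; $\nabla_{\theta\theta}\log p_\theta(z)\le K_3(z)I$; moreover $\lambda_{\min}(\mathbb E_P[\nabla_\theta\log p_{\theta^{KL}}(z)^\top\nabla_\theta\log p_{\theta^{KL}}(z)])\ge\lambda_1^{ETO}$; $\lambda_{\min}(-\nabla_{\theta\theta}\mathbb E_P[\log p_{\theta^{KL}}(z)])\ge\lambda_2^{ETO}$; $\|\nabla_\theta\log p_{\theta^{KL}}(z)\|_4\le c_4^{ETO}\sqrt q$. IEO regularity conditions: $c(w_\theta,z)$ is twice differentiable in $\theta$, and there are constants $\mu^{IEO},c_1^{IEO},c_2^{IEO},c_4^{IEO},\lambda_1^{IEO},\lambda_2^{IEO}>0$, $c_3^{IEO}\ge0$ and nonnegative functions $K_1,K_2,K_3$ on $\mathcal Z$ (possibly different from those above) with $\|K_1(z)\|_9\le c_1^{IEO}$, $\|K_2(z)\|_4\le c_2^{IEO}$, $\|K_3(z)\|_4\le c_3^{IEO}$ such that for all $\theta\in\Theta$, $z\in\mathcal Z$: $v_0(w_\theta)-v_0(w_{\theta^*})\ge\mu^{IEO}\|\theta-\theta^*\|^2$; $|c(w_\theta,z)-c(w_{\theta^*},z)|\le K_1(z)\|\theta-\theta^*\|$; $\|\nabla_{\theta\theta}c(w_\theta,z)-\nabla_{\theta\theta}c(w_{\theta^*},z)\|\le K_2(z)\|\theta-\theta^*\|$; $\nabla_{\theta\theta}c(w_{\theta^*},z)\le K_3(z)I$; moreover $\lambda_{\min}(\mathbb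 E_P[\nabla_\theta c(w_{\theta^*},z)^\top\nabla_\theta c(w_{\theta^*},z)])\ge\lambda_1^{IEO}$; $\lambda_{\min}(\nabla_{\theta\theta}\mathbb E_P[c(w_{\theta^*},z)])\ge\lambda_2^{IEO}$; $\|\nabla_\theta c(w_{\theta^*},z)\|_4\le c_4^{IEO}\sqrt q$. Smoothness and interchangeability condition: $v(w,\theta)$ is twice differentiable in $(w,\theta)$; $\theta\mapsto w_\theta$ is twice differentiable; any involved operations of integration and differentiation can be interchanged, specifically $\nabla_\theta\int\nabla_wc(w,z)^\top p_\theta(z)dz=\int\nabla_wc(w,z)^\top\nabla_\theta p_\theta(z)dz$ and $\int\nabla_wc(w,z)p_\theta(z)dz=\nabla_w\int c(w,z)p_\theta(z)dz$ for all $\theta\in\Theta$. Error terms $C$: $C^{ETO}_{n,q}:=C^{ETO}q^{9/4}n^{-1/2}$ and $C^{IEO}_{n,q}:=C^{IEO}q^{9/4}n^{-1/2}$, where $C^{ETO}>0$ (resp. $C^{IEO}>0$) is a constant depending only on $c_1,\dots,c_4,\mu,\lambda_1,\lambda_2$ of the ETO (resp. IEO) regularity conditions such that for every convex $A\subset\mathbb R^q$, $|\mathbb P(\sqrt n(\hat\theta^{ETO}-\theta^{KL})\in A)-\mathbb P(M_1^{ETO}Y_0\in A)|\le C^{ETO}_{n,q}$ (resp. $|\mathbb P(\sqrt n(\hat\theta^{IEO}-\theta^* )\in A)-\mathbb P(M_1^{IEO}Y_0\in A)|\le C^{IEO}_{n,q}$). Error terms $D$: $D^{ETO}_{n,q}$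 and $D^{IEO}_{n,q}$ are the error terms, independent of $t$, in the finite-sample bounds, for all $t>0$, $|\mathbb P(n(v_0(\hat w^{ETO})-v_0(w_{\theta^{KL}})-\nabla_\theta v_0(w_{\theta^{KL}})(\hat\theta^{ETO}-\theta^{KL}))\ge t)-\mathbb P(\mathbb G^{ETO}\ge t)|\le D^{ETO}_{n,q}$ and $|\mathbb P(n(v_0(\hat w^{IEO})-v_0(w_{\theta^*}))\ge t)-\mathbb P(\mathbb G^{IEO}\ge t)|\le D^{IEO}_{n,q}$. Their order is as follows. For $\bullet\in\{ETO,IEO\}$ let $\lambda_1,\dots,\lambda_q\ge0$ be the eigenvalues of $\frac12M_1^{ETO}\nabla_{\theta\theta}v_0(w_{\theta^{KL}})M_1^{ETO}$ if $\bullet=ETO$, and of $\frac12M_1^{IEO}\nabla_{\theta\theta}v_0(w_{\theta^*})M_1^{IEO}$ if $\bullet=IEO$. If $q=1$, $D^\bullet_{n,1}\lesssim\lambda_1^{-1/2}L_1^{1/2}\|M_1^\bullet\|^{3/2}(\log n)^{3/4}n^{-1/4}+C^\bullet_{n,1}$. If $q\ge2$, $D^\bullet_{n,q}\lesssim\big((\sum_{i=1}^q\lambda_i^2)(\sum_{i=2}^q\lambda_i^2)\big)^{-1/4}L_1\|M_1^\bullet\|^3q^{3/2}(\log n)^{3/2}n^{-1/2}+C^\bullet_{n,q}$. Here $\lesssim$ hides constants independent of $n$ and $q$. *)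

(* Defs.v *)
(* MathComp / MathComp-Analysis *)
From HB Require Import structures.
From mathcomp Require Export all_boot all_order all_algebra.
From mathcomp Require Export all_classical all_reals all_analysis.

Set Implicit Arguments.
Unset Strict Implicit.
Unset Printing Implicit Defensive.
Import Order.TTheory GRing.Theory Num.Theory.
Import numFieldNormedType.Exports.

Local Open Scope classical_set_scope.
Local Open Scope ring_scope.

(* Conventions.  Points of R^n are row vectors 'rV[R]_n, so that the
   column vector M Y0 is encoded by [Y *m M] (all such M are symmetric) and
   Y0^T A Y0 is [Y *m A *m Y^T].  The library norm on 'rV[R]_n is the max norm;
   it is only used for its topology, quantitative statements use [enorm]. *)

Section linear_algebra.
Context {R : realType}.

Definition enorm n (x : 'rV[R]_n) : R := Num.sqrt (\sum_i x 0 i ^+ 2).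

(* Spectral norm, for the action of A on row vectors; A and A^T have the same
   spectral norm. *)
Definition specnorm m n (A : 'M[R]_(m, n)) : R :=
  sup [set enorm (x *m A) | x in [set x : 'rV[R]_m | enorm x <= 1]].

Definition psd n (A : 'M[R]_n) : Prop :=
  A^T = A /\ forall x : 'rV[R]_n, 0 <= (x *m A *m x^T) 0 0.

Definition loewner_le n (A B : 'M[R]_n) : Prop := psd (B - A).

(* The default value 0 is only taken when A is not positive semidefinite. *)
Definition psd_sqrt n (A : 'M[R]_n) : 'M[R]_n :=
  xget 0 [set B : 'M[R]_n | psd B /\ B *m B = A].

Definition eigmin n (A : 'M[R]_n) : R := inf [set a | eigenvalue A a].
Definition eigmax n (A : 'M[R]_n) : R := sup [set a | eigenvalue A a].

(* lam 1, ..., lam n are the eigenvalues of A, with multiplicity. *)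
Definition eigenvalues_of n (A : 'M[R]_n) (lam : nat -> R) : Prop :=
  char_poly A = \prod_(1 <= i < n.+1) ('X - (lam i)%:P).

End linear_algebra.

Section calculus.
Context {R : realType}.

Definition grad n (f : 'rV[R]_n -> R) (x : 'rV[R]_n) : 'rV[R]_n :=
  \row_i 'D_(delta_mx 0 i) f x.

Definition hess n (f : 'rV[R]_n -> R) (x : 'rV[R]_n) : 'M[R]_n :=
  \matrix_(i, j) 'D_(delta_mx 0 j) (fun y => 'D_(delta_mx 0 i) f y) x.

Definition twice_differentiable n (f : 'rV[R]_n -> R) (x : 'rV[R]_n) : Prop :=
  (\forall y \near x, differentiable f y) /\ differentiable (grad f) x.

End calculus.

Definition borel (R : realType) (n : nat) := g_sigma_algebraType (@open 'rV[R]_n).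

Section probability.
Context {R : realType}.

(* Lebesgue measure on R^n, characterized by its values on boxes. *)
Definition is_lebesgue n (nu : {measure set (borel R n) -> \bar R}) : Prop :=
  forall a b : 'rV[R]_n, (forall i, a 0 i <= b 0 i) ->
    nu [set x : 'rV[R]_n | forall i, a 0 i < x 0 i <= b 0 i] =
    (\prod_(i < n) (b 0 i - a 0 i))%:E.

Definition intmx d (T : measurableType d) (mu : {measure set T -> \bar R})
    (D : set T) m n (G : T -> 'M[R]_(m, n)) : 'M[R]_(m, n) :=
  \matrix_(i, j) \int[mu]_(z in D) G z i j.

Definition integrable_mx d (T : measurableType d) (mu : {measure set T -> \bar R})
    (D : set T) m n (G : T -> 'M[R]_(m, n)) : Prop :=
  forall i j, mu.-integrable D (EFin \o (fun z => G z i j)).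

(* The law factorizes over finite products of Borel sets: this is at once mutual
   independence and the identification of the marginals with P. *)
Definition iid d (T : measurableType d) (Pr : probability T R) k
    (P : probability (borel R k) R) (z : nat -> T -> borel R k) : Prop :=
  (forall i, measurable_fun setT (z i)) /\
  forall (n : nat) (B : nat -> set (borel R k)), (forall i, measurable (B i)) ->
    Pr [set s | forall i, (i < n)%N -> B i (z i s)] = (\prod_(i < n) P (B i))%E.

(* Y ~ N(0, I_n) : the law of Y is the product of n copies of N(0, 1). *)
Definition std_gaussian d (T : measurableType d) (Pr : probability T R) n
    (Y : T -> borel R n) : Prop :=
  measurable_fun setT Y /\
  forall B : 'I_n -> set (measurableTypeR R), (forall i, measurable (B i)) ->
    Pr [set s | forall i, B i ((Y s : 'rV[R]_n) 0 i)] =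
    (\prod_(i < n) normal_prob 0 1 (B i))%E.

End probability.

(* thKL, thstar, wstar and wopt are the chosen (arg)minimizers and (arg)maximizers;
   see [setup]. *)
Record problem (R : realType) (p q d : nat) := Problem {
  Omega : set 'rV[R]_p ;
  Theta : set 'rV[R]_q ;
  Zset : set (borel R d) ;
  cost : 'rV[R]_p -> borel R d -> R ;
  truth : probability (borel R d) R ;
  family : 'rV[R]_q -> probability (borel R d) R ;
  density : 'rV[R]_q -> borel R d -> R ;
  wstar : 'rV[R]_p ;
  wopt : 'rV[R]_q -> 'rV[R]_p ;
  thKL : 'rV[R]_q ;
  thstar : 'rV[R]_q }.

Record reg_constants (R : realType) := RegConstants {
  mu_ : R ; c1_ : R ; c2_ : R ; c3_ : R ; c4_ : R ; lambda1_ : R ; lambda2_ : R }.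

Definition reg_constants_pos (R : realType) (k : reg_constants R) : Prop :=
  [/\ 0 < mu_ k, 0 < c1_ k, 0 < c2_ k & 0 < c4_ k] /\
  [/\ 0 < lambda1_ k, 0 < lambda2_ k & 0 <= c3_ k].

Section contextual_optimization.
Context {R : realType} {p q d : nat}.
Variable m : problem R p q d.
Local Notation P := (truth m).
Local Notation Z := (Zset m).
Local Notation Th := (Theta m).

Definition expect (Q : probability (borel R d) R) (f : borel R d -> R) : R :=
  \int[Q]_(z in Z) f z.

Definition v0 (w : 'rV[R]_p) : R := expect P (cost m w).
Definition v (w : 'rV[R]_p) (th : 'rV[R]_q) : R := expect (family m th) (cost m w).
Definition regret (w : 'rV[R]_p) : R := v0 w - v0 (wstar m).

Definition loglik (th : 'rV[R]_q) (z : borel R d) : R := ln (density m th z).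
Definition pcost (th : 'rV[R]_q) (z : borel R d) : R := cost m (wopt m th) z.
Definition v0w (th : 'rV[R]_q) : R := v0 (wopt m th).

Definition PKL : probability (borel R d) R := family m (thKL m).

Definition kappaETO : R := v0 (wopt m (thKL m)) - v0 (wstar m).
Definition kappaIEO : R := v0 (wopt m (thstar m)) - v0 (wstar m).
Definition delta : R := kappaETO - kappaIEO.

(* Densities are with respect to nu.  The integrability clauses say that all the
   expectations occurring in the definitions of v0, v and the log-likelihood
   are well defined and finite. *)
Definition setup (nu : {measure set (borel R d) -> \bar R}) : Prop :=
  [/\ open (Omega m), open Th, measurable Z & P Z = 1%E] /\
  [/\ (forall th, Th th -> [/\ family m th Z = 1%E,
        measurable_fun Z (density m th),
        (forall z, Z z -> 0 <= density m th z) &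
        forall A, measurable A ->
          family m th A = (\int[nu]_(z in A `&` Z) (density m th z)%:E)%E]),
      (forall w, Omega m w -> P.-integrable Z (EFin \o cost m w)),
      (forall w th, Omega m w -> Th th ->
        (family m th).-integrable Z (EFin \o cost m w)) &
      (forall th, Th th -> P.-integrable Z (EFin \o loglik th))] /\
  [/\ Omega m (wstar m) /\ (forall w, Omega m w -> v0 (wstar m) <= v0 w),
      (forall th, Th th -> Omega m (wopt m th) /\
        forall w, Omega m w -> v (wopt m th) th <= v w th),
      Th (thKL m) /\ (forall th, Th th ->
        expect P (loglik th) <= expect P (loglik (thKL m))) &
      Th (thstar m) /\ (forall th, Th th ->
        v0 (wopt m (thstar m)) <= v0 (wopt m th))].

Definition score (th : 'rV[R]_q) (z : borel R d) : 'rV[R]_q :=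
  grad (fun t => loglik t z) th.
Definition gcost (th : 'rV[R]_q) (z : borel R d) : 'rV[R]_q :=
  grad (fun t => pcost t z) th.

Definition expect_mx (Q : probability (borel R d) R) a b
  (G : borel R d -> 'M[R]_(a, b)) : 'M[R]_(a, b) := intmx Q Z G.

Definition var (Q : probability (borel R d) R) (g : borel R d -> 'rV[R]_q) : 'M[R]_q :=
  expect_mx Q (fun z => (g z - expect_mx Q g)^T *m (g z - expect_mx Q g)).

Definition hess_v0 (th : 'rV[R]_q) : 'M[R]_q := hess v0w th.
Definition hess_vQ (Q : probability (borel R d) R) (th : 'rV[R]_q) : 'M[R]_q :=
  hess (fun t => expect Q (pcost t)) th.
Definition hess_lQ (Q : probability (borel R d) R) (th : 'rV[R]_q) : 'M[R]_q :=
  hess (fun t => expect Q (loglik t)) th.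

Definition sandwich (H V : 'M[R]_q) : 'M[R]_q :=
  psd_sqrt (invmx H *m V *m invmx H).

Definition M1ETO : 'M[R]_q :=
  sandwich (hess_lQ P (thKL m)) (var P (score (thKL m))).
Definition M1IEO : 'M[R]_q :=
  sandwich (hess_v0 (thstar m)) (var P (gcost (thstar m))).
Definition M1ETO_KL : 'M[R]_q :=
  sandwich (hess_lQ PKL (thKL m)) (var PKL (score (thKL m))).
Definition M1IEO_KL : 'M[R]_q :=
  sandwich (hess_vQ PKL (thKL m)) (var PKL (gcost (thKL m))).

Definition curvETO : 'M[R]_q := M1ETO *m hess_v0 (thKL m) *m M1ETO.
Definition curvIEO : 'M[R]_q := M1IEO *m hess_v0 (thstar m) *m M1IEO.

Definition Smx : 'M[R]_q :=
  M1IEO_KL *m hess_v0 (thstar m) *m M1IEO_KL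
  - M1ETO_KL *m hess_v0 (thstar m) *m M1ETO_KL.
Definition Deltamx : 'M[R]_q := (curvIEO - curvETO) - Smx.

Definition tau1 : R := eigmin (curvIEO - curvETO).
Definition tau3 : R := eigmin Smx.
Definition tau6 : R := eigmax curvETO.

Definition GETO (Y : 'rV[R]_q) : R := 2^-1 * (Y *m curvETO *m Y^T) 0 0.
Definition GIEO (Y : 'rV[R]_q) : R := 2^-1 * (Y *m curvIEO *m Y^T) 0 0.

(* The last two clauses make the covariances under P^KL well defined (those under
   P exist by the regularity conditions). *)
Definition misspecification (B0 : R) : Prop :=
  0 <= B0 /\
  [/\ specnorm (hess_lQ P (thKL m) - hess_lQ PKL (thKL m)) <= B0,
      specnorm (var P (score (thKL m)) - var PKL (score (thKL m))) <= B0,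
      specnorm (hess_v0 (thstar m) - hess_vQ PKL (thKL m)) <= B0,
      specnorm (var P (gcost (thstar m)) - var PKL (gcost (thKL m))) <= B0 &
      specnorm (hess_v0 (thstar m) - hess_v0 (thKL m)) <= B0] /\
  (forall i, PKL.-integrable Z (EFin \o (fun z => score (thKL m) z 0 i ^+ 2))) /\
  (forall i, PKL.-integrable Z (EFin \o (fun z => gcost (thKL m) z 0 i ^+ 2))).

Definition lipschitz_hessian (L1 : R) : Prop :=
  [/\ bounded_set Th,
      (forall th, Th th -> twice_differentiable v0w th) &
      forall th1 th2, Th th1 -> Th th2 ->
        specnorm (hess_v0 th1 - hess_v0 th2) <= L1 * enorm (th1 - th2)].

Section consistency.
Context (dS : measure_display) (S : measurableType dS) (Pr : probability S R).
Variable z : nat -> S -> borel R d.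

Definition emp_mean (f : borel R d -> R) (n : nat) (s : S) : R :=
  n%:R^-1 * \sum_(i < n) f (z i s).

(* sup over Theta of |empirical mean - expectation| tends to 0 in probability.
   The supremum need not be measurable, whence the outer measure [mu_ext Pr],
   which agrees with Pr on measurable sets. *)
Definition uniform_lln (f : 'rV[R]_q -> borel R d -> R) : Prop :=
  forall eps : R, 0 < eps ->
    mu_ext Pr [set s | (eps%:E < ereal_sup
      [set `|emp_mean (f th) n s - expect P (f th)|%:E | th in Th])%E]
    @[n --> \oo] --> 0%E.

Definition ETO_consistency : Prop :=
  uniform_lln loglik /\
  forall eps : R, 0 < eps ->
    (ereal_sup [set (expect P (loglik th))%:E | th in
       Th `&` [set th | (eps <= enorm (th - thKL m))%R]]
     < (expect P (loglik (thKL m)))%:E)%E.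

Definition IEO_consistency : Prop :=
  uniform_lln pcost /\
  forall eps : R, 0 < eps ->
    ((v0w (thstar m))%:E <
     ereal_inf [set (v0w th)%:E | th in
       Th `&` [set th | (eps <= enorm (th - thstar m))%R]])%E.

Definition ETO_estimator (that : nat -> S -> borel R q) : Prop :=
  forall n, (0 < n)%N -> measurable_fun setT (that n) /\
    forall s, Th (that n s) /\
      forall th, Th th -> emp_mean (loglik th) n s <= emp_mean (loglik (that n s)) n s.

Definition IEO_estimator (that : nat -> S -> borel R q) : Prop :=
  forall n, (0 < n)%N -> measurable_fun setT (that n) /\
    forall s, Th (that n s) /\
      forall th, Th th -> emp_mean (pcost (that n s)) n s <= emp_mean (pcost th) n s.

End consistency.

(* ||X||_r for a real random variable defined on Zset. *)
Definition mnorm (r : nat) (f : borel R d -> R) : \bar R :=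
  Lnorm P r%:R%:E (EFin \o (f \_ Z)).

Definition dominating (r : nat) (K : borel R d -> R) (c : R) : Prop :=
  [/\ measurable_fun Z K, (forall z, Z z -> 0 <= K z) & (mnorm r K <= c%:E)%E].

(* Positivity of the densities on Zset is part of log p_theta being a
   (real-valued) differentiable function. *)
Definition ETO_regular (k : reg_constants R) : Prop :=
  reg_constants_pos k /\
  (forall th z, Th th -> Z z ->
    0 < density m th z /\ twice_differentiable (fun t => loglik t z) th) /\
  (exists K1 K2 K3 : borel R d -> R,
    [/\ dominating 9 K1 (c1_ k), dominating 4 K2 (c2_ k) & dominating 4 K3 (c3_ k)] /\
    forall th z, Th th -> Z z ->
      [/\ expect P (loglik (thKL m)) - expect P (loglik th)
            >= mu_ k * enorm (th - thKL m) ^+ 2,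
          `|loglik th z - loglik (thKL m) z| <= K1 z * enorm (th - thKL m),
          specnorm (hess (fun t => loglik t z) th - hess (fun t => loglik t z) (thKL m))
            <= K2 z * enorm (th - thKL m) &
          loewner_le (hess (fun t => loglik t z) th) (K3 z)%:M]) /\
  [/\ lambda1_ k <= eigmin (expect_mx P (fun z =>
        (score (thKL m) z)^T *m score (thKL m) z)),
      lambda2_ k <= eigmin (- hess_lQ P (thKL m)) &
      (mnorm 4 (fun z => enorm (score (thKL m) z)) <= (c4_ k * Num.sqrt q%:R)%:E)%E].

Definition IEO_regular (k : reg_constants R) : Prop :=
  reg_constants_pos k /\
  (forall th z, Th th -> Z z -> twice_differentiable (fun t => pcost t z) th) /\
  (exists K1 K2 K3 : borel R d -> R,
    [/\ dominating 9 K1 (c1_ k), dominating 4 K2 (c2_ k) & dominating 4 K3 (c3_ k)] /\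
    forall th z, Th th -> Z z ->
      [/\ v0w th - v0w (thstar m) >= mu_ k * enorm (th - thstar m) ^+ 2,
          `|pcost th z - pcost (thstar m) z| <= K1 z * enorm (th - thstar m),
          specnorm (hess (fun t => pcost t z) th - hess (fun t => pcost t z) (thstar m))
            <= K2 z * enorm (th - thstar m) &
          loewner_le (hess (fun t => pcost t z) (thstar m)) (K3 z)%:M]) /\
  [/\ lambda1_ k <= eigmin (expect_mx P (fun z =>
        (gcost (thstar m) z)^T *m gcost (thstar m) z)),
      lambda2_ k <= eigmin (hess_vQ P (thstar m)) &
      (mnorm 4 (fun z => enorm (gcost (thstar m) z)) <= (c4_ k * Num.sqrt q%:R)%:E)%E].

(* First- and second-order differentiation under E_Q, at the points of D. *)
Definition interchange (Q : probability (borel R d) R)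
    (f : 'rV[R]_q -> borel R d -> R) (D : set 'rV[R]_q) : Prop :=
  (forall th, Th th -> Q.-integrable Z (EFin \o f th)) /\
  forall th, D th ->
    [/\ twice_differentiable (fun t => expect Q (f t)) th,
        integrable_mx Q Z (fun z => grad (fun t => f t z) th),
        integrable_mx Q Z (fun z => hess (fun t => f t z) th),
        grad (fun t => expect Q (f t)) th
          = expect_mx Q (fun z => grad (fun t => f t z) th) &
        hess (fun t => expect Q (f t)) th
          = expect_mx Q (fun z => hess (fun t => f t z) th)].

(* 'J is the transpose of the usual Jacobian matrix (it acts on row vectors). *)
Definition smooth_interchange (nu : {measure set (borel R d) -> \bar R}) : Prop :=
  [/\ (forall w th, Omega m w -> Th th ->
        twice_differentiable
          (fun u : 'rV[R]_(p + q) => v (lsubmx u) (rsubmx u)) (row_mx w th)),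
      (forall th i, Th th -> twice_differentiable (fun t => wopt m t 0 i) th),
      [/\ interchange P loglik Th, interchange P pcost Th,
          interchange PKL loglik [set thKL m] & interchange PKL pcost [set thKL m]] &
      forall w th, Omega m w -> Th th ->
        let gw z := grad (fun u => cost m u z) w in
        let gp z := grad (fun t => density m t z) th in
        (forall z, Z z -> differentiable (fun u => cost m u z) w) /\
        [/\ integrable_mx nu Z (fun z => density m th z *: gw z),
            integrable_mx nu Z (fun z => (gw z)^T *m gp z),
            differentiable (fun t => intmx nu Z (fun z => density m t z *: gw z)) th,
            ('J (fun t => intmx nu Z (fun z => density m t z *: gw z)) th)^T
              = intmx nu Z (fun z => (gw z)^T *m gp z) &
            intmx nu Z (fun z => density m th z *: gw z)
              = grad (fun u => \int[nu]_(z in Z) (cost m u z * density m th z)) w]].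

Section error_terms.
Context (dS : measure_display) (S : measurableType dS) (Pr : probability S R).
Context (dS' : measure_display) (S' : measurableType dS') (PrY : probability S' R).
Variable Y : S' -> borel R q.

Definition Cterm (C : R) (n : nat) : R := C * q%:R `^ (9 / 4) * n%:R `^ (- (1 / 2)).

(* Measurable convex sets only, since not all convex sets are Borel. *)
Definition normal_approx (that : nat -> S -> borel R q) (th0 : 'rV[R]_q)
    (M : 'M[R]_q) (C : nat -> R) : Prop :=
  forall n, (0 < n)%N -> forall A : set (borel R q), measurable A ->
    convex_set (A : set (convex_lmodType 'rV[R]_q)) ->
    `| fine (Pr [set s | A (Num.sqrt n%:R *: ((that n s : 'rV[R]_q) - th0))])
       - fine (PrY [set s | A ((Y s : 'rV[R]_q) *m M)]) | <= C n.

Definition ETO_bound (that : nat -> S -> borel R q) (D : nat -> R) : Prop :=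
  forall n, (0 < n)%N -> forall t : R, 0 < t ->
    `| fine (Pr [set s | t <= n%:R * (v0 (wopt m (that n s)) - v0 (wopt m (thKL m))
         - (grad v0w (thKL m) *m ((that n s : 'rV[R]_q) - thKL m)^T) 0 0)])
       - fine (PrY [set s | t <= GETO (Y s)]) | <= D n.

Definition IEO_bound (that : nat -> S -> borel R q) (D : nat -> R) : Prop :=
  forall n, (0 < n)%N -> forall t : R, 0 < t ->
    `| fine (Pr [set s | t <= n%:R * (v0 (wopt m (that n s)) - v0 (wopt m (thstar m)))])
       - fine (PrY [set s | t <= GIEO (Y s)]) | <= D n.

Definition rate_base (lam : nat -> R) : R :=
  if q == 1%N then lam 1%N
  else (\sum_(1 <= i < q.+1) lam i ^+ 2) * (\sum_(2 <= i < q.+1) lam i ^+ 2).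

Definition Drate (lam : nat -> R) (L1 : R) (M : 'M[R]_q) (n : nat) : R :=
  if q == 1%N then
    rate_base lam `^ (- (1 / 2)) * L1 `^ (1 / 2) * specnorm M `^ (3 / 2)
      * ln n%:R `^ (3 / 4) * n%:R `^ (- (1 / 4))
  else
    rate_base lam `^ (- (1 / 4)) * L1 * specnorm M ^+ 3 * q%:R `^ (3 / 2)
      * ln n%:R `^ (3 / 2) * n%:R `^ (- (1 / 2)).

(* lam 1, ..., lam q are the eigenvalues of A.  The negative power of [rate_base]
   is only meaningful when [rate_base] is positive. *)
Definition Dorder (K : R) (A : 'M[R]_q) (lam : nat -> R) (L1 : R) (M : 'M[R]_q)
    (C D : nat -> R) : Prop :=
  [/\ eigenvalues_of A lam,
      (forall i, (0 < i <= q)%N -> 0 <= lam i),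
      0 < rate_base lam &
      forall n, (1 < n)%N -> D n <= K * (Drate lam L1 M n + C n)].

End error_terms.

(* exp (- n eps^2 / (2 ||grad v0 M1||^2)), read as exp (-oo) = 0 when the gradient
   term vanishes. *)
Definition Eterm (eps : R) (n : nat) : R :=
  let a := enorm (grad v0w (thKL m) *m M1ETO) in
  if a == 0 then 0 else expR (- (n%:R * eps ^+ 2 / (2 * a ^+ 2))).

End contextual_optimization.

(* Main.v *)
(** Up to a constant, n times the ETO regret is the linear term of the expansion of
    v0(w_theta) at theta^KL plus a second-order term, so P(R(ETO) >= t) is at most the
    tail of the second-order term, which is that of G^ETO up to D, plus the tail of the
    linear term, which is that of a Gaussian linear form up to C (a half-space is
    convex) and is bounded by Chernoff's inequality. When delta = 0, theta^KL minimizes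
    v0(w_theta) over the open set Theta, so the linear term vanishes. Since curvIEO -
    curvETO >= tau1 and curvETO <= tau6, pointwise G^IEO >= (1 + tau1 / tau6) G^ETO, so
    {G^ETO >= s} is contained in {G^IEO >= (1 + tau1 / tau6) s}. The end point of the
    interval costs nothing because a quadratic form of a Gaussian vector with a nonzero
    diagonal entry has no atom: conditionally on the other coordinates it is a
    nonconstant quadratic polynomial in one Gaussian variable. *)
From HB Require Import structures.
Require Import Defs.
From mathcomp Require Import measurable_realfun ring lra.
Import Order.TTheory GRing.Theory Num.Theory.
Import numFieldNormedType.Exports.
Local Open Scope classical_set_scope.
Local Open Scope ring_scope.
Set Implicit Arguments.
Unset Strict Implicit.
Unset Printing Implicit Defensive.

(** * Independence of the coordinates and Gaussian vectors *)

Section independent_pair.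
Local Open Scope ereal_scope.
Context {R : realType} d (T : measurableType d) (P : probability T R).
Context d1 d2 (T1 : measurableType d1) (T2 : measurableType d2).
Variables (mu : probability T1 R) (X : T -> T1) (V : T -> T2).
Hypotheses (mX : measurable_fun setT X) (mV : measurable_fun setT V).
Hypothesis PXV : forall A C, measurable A -> measurable C ->
  P (X @^-1` A `&` V @^-1` C) = mu A * P (V @^-1` C).

(** By [PXV], the law of [(X, V)] agrees on rectangles with the product of [mu] and the law of [V],
    hence everywhere by uniqueness of product measures. Tonelli's theorem then integrates [x]
    first. *)
Lemma integral_independent (f : T1 * T2 -> \bar R) :
  measurable_fun setT f -> (forall u, 0 <= f u) ->
  \int[P]_s f (X s, V s) = \int[P]_s \int[mu]_x f (x, V s).
Proof.
move=> mf f0.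
pose V' : {mfun T >-> _} := HB.pack V (isMeasurableFun.Build _ _ _ _ V mV).
have mXV : measurable_fun setT (fun s => (X s, V s)).
  exact/measurable_fun_pair.
rewrite -[LHS]/(\int[P]_s (f \o (fun s => (X s, V s))) s).
rewrite -(preimage_setT (fun s => (X s, V s))).
rewrite -ge0_integral_pushforward//.
rewrite (@eq_measure_integral _ _ _ _ (mu \x distribution P V')); last first.
  by move=> E mE _; symmetry; apply: product_measure_unique.
rewrite fubini_tonelli2//.
rewrite -[RHS]/(\int[P]_s ((fun v => \int[mu]_x f (x, v)) \o V') s).
rewrite -[in RHS](preimage_setT V') -[in RHS]ge0_integral_pushforward//.
  by apply: measurable_fun_fubini_tonelli_G.
by move=> v _; apply: integral_ge0.
Qed.

End independent_pair.

Section independent_coordinates.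
Local Open Scope ereal_scope.
Context {R : realType} {q : nat} d (T : measurableType d) (P : probability T R).
Variables (mu : probability (measurableTypeR R) R).
Variable X : 'I_q -> T -> measurableTypeR R.
Hypothesis mX : forall i, measurable_fun setT (X i).
Hypothesis PX : forall B : 'I_q -> set (measurableTypeR R),
  (forall i, measurable (B i)) ->
  P [set s | forall i, B i (X i s)] = \prod_(i < q) mu (B i).

(* The coordinate i is frozen to 0 rather than dropped, to keep the index type. *)
Definition others (i : 'I_q) (s : T) : q.-tuple (measurableTypeR R) :=
  [tuple (if j == i then 0%R else X j s) | j < q].

Lemma measurable_others i : measurable_fun setT (others i).
Proof.
apply/measurable_fun_tnthP => j.
have [->|ji] := eqVneq j i.
  rewrite (_ : _ \o _ = cst 0%R)//; apply/funext => s /=.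
  by rewrite tnth_mktuple eqxx.
rewrite (_ : _ \o _ = X j)//; apply/funext => s /=.
by rewrite tnth_mktuple (negbTE ji).
Qed.

Definition boxes : set (set (q.-tuple (measurableTypeR R))) :=
  [set C | exists2 B : 'I_q -> set (measurableTypeR R),
     (forall i, measurable (B i)) & C = [set t | forall i, B i (tnth t i)]].

(** Provides a generator closed under intersection. A coordinate cylinder is a box whose other sides
    are [setT], and a box is a finite intersection of cylinders. *)
Lemma measurable_boxes : measurable = <<s boxes >>.
Proof.
rewrite eqEsubset; split.
- apply: smallest_sub; first exact: smallest_sigma_algebra.
  rewrite -bigcup_seq => A [i _ [B mB <-]]; rewrite setTI.
  apply: sub_sigma_algebra; exists (fun j => if j == i then B else setT).
    by move=> j; case: ifP.
  rewrite eqEsubset; split => t /=.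
    by move=> Bt j; case: ifPn => // /eqP ->.
  by move=> /(_ i); rewrite eqxx.
- apply: smallest_sub; first exact: sigma_algebra_measurable.
  move=> _ [B mB ->].
  rewrite (_ : [set t | _] =
      \bigcap_(i in [set: 'I_q]) ((fun t => tnth t i) @^-1` (B i))).
    apply: fin_bigcap_measurable; first exact: finite_finset.
    move=> i _; rewrite -[X in measurable X]setTI.
    exact: measurable_tnth.
  by rewrite eqEsubset; split => [t Bt i _|t Bt i]; apply: Bt.
Qed.

(** For fixed [A], both sides are finite measures of [C]; by [PX] they agree on boxes, and such
    measures are determined by their values on boxes. *)
Lemma independent_others i A C : measurable A -> measurable C ->
  P (X i @^-1` A `&` others i @^-1` C) = mu A * P (others i @^-1` C).
Proof.
move=> mA mC.
have mXA : measurable (X i @^-1` A) by rewrite -[X in measurable X]setTI; exact: mX.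
pose V : {mfun T >-> _} := HB.pack (others i)
   (isMeasurableFun.Build _ _ _ _ (others i) (measurable_others i)).
have muA : (0 <= fine (mu A))%R by rewrite fine_ge0.
have muAfin : mu A \is a fin_num by rewrite fin_num_measure.
pose m1 : {measure set _ -> \bar R} :=
  measure_function_pushforward__canonical__measure_function_Measure
    (mrestr P mXA) (measurable_others i).
pose m2 : {measure set _ -> \bar R} := mscale (NngNum muA) (distribution P V).
suff: m1 C = m2 C.
  by rewrite /m1 /m2 /= /pushforward /mrestr /mscale /= fineK// setIC.
apply: (measure_unique boxes (fun=> setT)) => //.
- exact: measurable_boxes.
- move=> _ _ [B mB ->] [B' mB' ->]; exists (fun j => B j `&` B' j).
    by move=> j; exact: measurableI.
  rewrite eqEsubset; split => t /=; first by move=> [b b'] j; split.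
  by move=> bb'; split => j; have [] := bb' j.
- move=> n; exists (fun=> setT) => //.
  by rewrite eqEsubset; split => t.
- by rewrite bigcup_const.
- move=> _ [B mB ->].
  rewrite /m1 /m2 /= /pushforward /mrestr /mscale /= fineK//.
  have tE j s : tnth (others i s) j = if j == i then 0%R else X j s.
    by rewrite tnth_mktuple.
  rewrite /distribution /pushforward.
  have [B0|B0] := pselect (B i 0%R); last first.
    rewrite (_ : _ @^-1` _ = set0); first by rewrite set0I measure0 mule0.
    by rewrite -subset0 => s /= /(_ i); rewrite tE eqxx.
  pose B' D j := if j == i then D else B j.
  have mB' D : measurable D -> forall j, measurable (B' D j).
    by move=> mD j; rewrite /B'; case: ifP.
  have -> : V @^-1` [set t | forall i, B i (tnth t i)] `&` (X i) @^-1` A =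
      [set s | forall j, B' A j (X j s)].
    rewrite eqEsubset; split => s /=.
      move=> [Bs As] j; rewrite /B'; case: ifPn => [/eqP ->//|ji].
      by have := Bs j; rewrite tE (negbTE ji).
    move=> Bs; split; last by have := Bs i; rewrite /B' eqxx.
    move=> j; rewrite tE; have := Bs j; rewrite /B'.
    by case: ifPn => // /eqP ->.
  have -> : V @^-1` [set t | forall i, B i (tnth t i)] =
      [set s | forall j, B' setT j (X j s)].
    rewrite eqEsubset; split => s /=.
      move=> Bs j; rewrite /B'; case: ifPn => // ji.
      by have := Bs j; rewrite tE (negbTE ji).
    move=> Bs j; rewrite tE; have := Bs j; rewrite /B'.
    by case: ifPn => // /eqP ->.
  rewrite !PX; [|exact: mB'|exact: mB'].
  rewrite (bigD1 i)//= [in RHS](bigD1 i)//= /B' eqxx probability_setT mul1e.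
  by congr (_ * _); apply: eq_bigr => j ji; rewrite (negbTE ji).
- move=> n; rewrite /m1 /= /pushforward /mrestr.
  by rewrite preimage_setT setTI ltey_eq fin_num_measure.
Qed.

End independent_coordinates.

(** * Gaussian vectors: exponential moments, tails of linear forms, absence of atoms for quadratic
    forms *)

Section gaussian_vectors.
Local Open Scope ereal_scope.
Context {R : realType}.

Lemma measurable_rV_continuous q (f : 'rV[R]_q -> R) : continuous f ->
  measurable_fun setT (f : borel R q -> measurableTypeR R).
Proof.
move=> /continuousP cf; apply: (measurability _ (RGenOpens.measurableE R)).
move=> _ [_ [a [b ->] <-]]; rewrite setTI.
by apply: sub_sigma_algebra; apply: cf; exact: interval_open.
Qed.

Lemma measurable_coord q (i : 'I_q) :
  measurable_fun setT ((fun x : 'rV[R]_q => x 0%R i) : borel R q -> measurableTypeR R).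
Proof. by apply: measurable_rV_continuous => x; exact: coord_continuous. Qed.

(** The Radon-Nikodym derivative of [normal_prob] and [normal_pdf] have the same integral over every
    measurable set, so they agree almost everywhere. *)
Lemma ge0_integral_normal_prob (m s : R) (f : R -> \bar R) :
  measurable_fun setT f -> (forall x, 0 <= f x) ->
  \int[normal_prob m s]_x f x =
  \int[lebesgue_measure]_x (f x * (normal_pdf m s x)%:E).
Proof.
move=> mf f0.
have dom := @normal_prob_dominates R m s.
rewrite -(Radon_Nikodym_SigmaFinite.change_of_variables dom)//.
apply: ae_eq_integral => //.
- apply: emeasurable_funM => //.
  by apply: (measurable_int lebesgue_measure); exact: Radon_Nikodym_SigmaFinite.f_integrable.
- by apply: emeasurable_funM => //; apply/measurable_EFinP; exact: measurable_normal_pdf.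
- apply: ae_eqe_mul2l; apply: integral_ae_eq => //.
  + exact: Radon_Nikodym_SigmaFinite.f_integrable.
  + by apply/measurable_EFinP; exact: measurable_normal_pdf.
  + by move=> A _ mA; rewrite -Radon_Nikodym_SigmaFinite.f_integral.
Qed.

Lemma measurable_expRM (b : R) : measurable_fun setT (fun x : R => (expR (b * x))%:E).
Proof.
by apply/measurable_EFinP; apply: measurableT_comp => //; exact: measurable_funM.
Qed.

(** Completing the square turns the weighted standard density into [expR (b ^+ 2 / 2)] times the
    density of N(b, 1), whose total mass is 1. *)
Lemma normal_mgf (b : R) :
  \int[normal_prob 0 1]_x (expR (b * x))%:E = (expR (b ^+ 2 / 2))%:E.
Proof.
rewrite ge0_integral_normal_prob//; last exact: measurable_expRM.
transitivity (\int[lebesgue_measure]_x ((expR (b ^+ 2 / 2))%:E * (normal_pdf b 1 x)%:E)).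
  apply: eq_integral => x _.
  rewrite -!EFinM !normal_pdfE ?oner_eq0// mulrCA [in RHS]mulrCA /normal_fun.
  by rewrite -!expRD; congr ((_ * expR _)%:E); field.
rewrite ge0_integralZl//.
- by rewrite integral_normal_pdf mule1.
- by apply/measurable_EFinP; exact: measurable_normal_pdf.
- by move=> x _; rewrite lee_fin normal_pdf_ge0.
Qed.

Context {q : nat} d (T : measurableType d) (P : probability T R) (Y : T -> borel R q).
Hypothesis hY : std_gaussian P Y.

Let X (i : 'I_q) : T -> measurableTypeR R := fun s => (Y s : 'rV[R]_q) 0%R i.

Lemma gaussian_coord i : measurable_fun setT (X i).
Proof. by apply: (measurableT_comp (measurable_coord i)); exact: hY.1. Qed.

Let mX := gaussian_coord.

Let tnth_others i j s : j != i -> tnth (others X i s) j = X j s.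
Proof. by move=> ji; rewrite tnth_mktuple (negbTE ji). Qed.

Lemma integral_gaussian_coord i
    (f : R * q.-tuple (measurableTypeR R) -> \bar R) :
  measurable_fun setT f -> (forall u, 0 <= f u) ->
  \int[P]_s f (X i s, others X i s) =
  \int[P]_s \int[normal_prob 0 1]_x f (x, others X i s).
Proof.
move=> mf f0; apply: integral_independent => //.
- exact: measurable_others.
- by move=> A C mA mC; apply: independent_others => // B mB; exact: hY.2.
Qed.

Lemma measurable_linear_tuple (c : 'I_q -> R) (p : pred 'I_q) :
  measurable_fun setT
    (fun v : q.-tuple (measurableTypeR R) => \sum_(j | p j) c j * tnth v j)%R.
Proof.
under eq_fun do rewrite big_mkcond.
apply: measurable_sum => j; case: (p j) => //.
by apply: measurable_funM => //; exact: measurable_tnth.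
Qed.

Lemma gaussian_linear_mgf (b : 'I_q -> R) :
  \int[P]_s (expR (\sum_i b i * X i s))%:E = (expR ((\sum_i b i ^+ 2) / 2))%:E.
Proof.
(* Induction on the number [k] of coordinates in the sum: integrating out the newest one,
   independent of the earlier ones, contributes one factor given by [normal_mgf]. *)
suff H k : (k <= q)%N -> \int[P]_s (expR (\sum_(i < q | (i < k)%N) b i * X i s))%:E
    = (expR ((\sum_(i < q | (i < k)%N) b i ^+ 2) / 2))%:E.
  rewrite (eq_bigl (fun i : 'I_q => (i < q)%N)); last by move=> i; rewrite ltn_ord.
  rewrite -H//; apply: eq_integral => s _; congr (expR _)%:E.
  by apply: eq_bigl => i; rewrite ltn_ord.
elim: k => [_|k IH kq].
  under eq_integral do rewrite big_pred0// expR0.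
  rewrite integral_cst// big_pred0// mul0r expR0 mul1e; exact: probability_setT.
pose i0 := Ordinal kq.
have sumS (F : 'I_q -> R) : (\sum_(i < q | (i < k.+1)%N) F i =
    F i0 + \sum_(i < q | (i < k)%N) F i)%R.
  rewrite (bigD1 i0) ?ltnS//=; congr (_ + _)%R; apply: eq_bigl => i.
  by rewrite ltnS ltn_neqAle andbC -(inj_eq val_inj).
pose h (v : q.-tuple (measurableTypeR R)) := (\sum_(j < q | (j < k)%N) b j * tnth v j)%R.
have mh : measurable_fun setT h by exact: measurable_linear_tuple.
pose f (u : R * q.-tuple (measurableTypeR R)) := (expR (b i0 * u.1 + h u.2))%:E.
have mf : measurable_fun setT f.
  apply/measurable_EFinP; apply: measurableT_comp => //.
  by apply: measurable_funD; [exact: measurable_funM|exact: measurableT_comp].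
have hX s : h (others X i0 s) = (\sum_(i < q | (i < k)%N) b i * X i s)%R.
  apply: eq_bigr => j jk; rewrite tnth_others//.
  by rewrite -(inj_eq val_inj) /= ltn_eqF.
transitivity (\int[P]_s f (X i0 s, others X i0 s)).
  by apply: eq_integral => s _; rewrite /f /= hX sumS.
rewrite integral_gaussian_coord//; last by move=> u; rewrite lee_fin expR_ge0.
transitivity (\int[P]_s ((expR (b i0 ^+ 2 / 2))%:E *
    (expR (\sum_(i < q | (i < k)%N) b i * X i s))%:E)).
  apply: eq_integral => s _; rewrite -hX -normal_mgf -ge0_integralZr//.
  - by apply: eq_integral => x _; rewrite /f /= expRD EFinM.
  - exact: measurable_expRM.
rewrite ge0_integralZl//.
- by rewrite IH 1?ltnW// -EFinM -expRD sumS mulrDl.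
- apply/measurable_EFinP; apply: measurableT_comp => //.
  under eq_fun do rewrite -hX.
  by apply: measurableT_comp => //; exact: measurable_others.
Qed.

Lemma measurable_gaussian_linear (b : 'I_q -> R) :
  measurable_fun setT (fun s => \sum_i b i * X i s)%R.
Proof.
by apply: measurable_sum => i; apply: measurable_funM => //; exact: mX.
Qed.

Lemma gaussian_linear_tail (b : 'I_q -> R) (t : R) :
  (0 <= t)%R -> (0 < \sum_i b i ^+ 2)%R ->
  P [set s | t <= \sum_i b i * X i s]%R <=
  (expR (- (t ^+ 2 / (2 * \sum_i b i ^+ 2))))%:E.
Proof.
set a := (\sum_i b i ^+ 2)%R => t0 a0.
have mS := measurable_gaussian_linear b.
have mE : measurable [set s | t <= \sum_i b i * X i s]%R.
  rewrite -[X in measurable X]setTI (_ : [set s | _] =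
    (fun s => \sum_i b i * X i s)%R @^-1` `[t, +oo[%classic).
    by apply: mS.
  by rewrite eqEsubset; split => s /=; rewrite in_itv/= andbT.
(* Chernoff bound with the optimal parameter [t / a] *)
pose l := (t / a)%R.
rewrite -(setIT [set s | _ <= _]%R) -integral_indic//.
have mexp (c : 'I_q -> R) : measurable_fun setT (fun s => (expR (\sum_i c i * X i s))%:E).
  apply/measurable_EFinP; apply: measurableT_comp => //.
  exact: measurable_gaussian_linear.
apply: (@le_trans _ _ (\int[P]_s ((expR (- (t * l)))%:E *
    (expR (\sum_i (l * b i) * X i s))%:E))).
  apply: ge0_le_integral => //.
  - by apply/measurable_EFinP; exact: measurable_indic.
  - exact: measurable_funeM.
  - move=> s _; rewrite -EFinM lee_fin -expRD indicE.
    case: (boolP (s \in _)) => [|_]; last exact: expR_ge0.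
    rewrite inE /= => ts; rewrite -expR0 ler_expR.
    under eq_bigr do rewrite -mulrA.
    rewrite -mulr_sumr addrC mulrC -mulrBl.
    by rewrite mulr_ge0 ?subr_ge0// divr_ge0// ltW.
rewrite ge0_integralZl//.
- rewrite gaussian_linear_mgf -EFinM -expRD lee_fin ler_expR.
  under eq_bigr do rewrite exprMn.
  rewrite -mulr_sumr -/a /l.
  rewrite le_eqVlt; apply/orP; left; apply/eqP; field.
  by rewrite gt_eqF.
Qed.

(** A quadratic polynomial has finitely many roots, so its zero set is Lebesgue null, and the normal
    law is dominated by Lebesgue measure. *)
Lemma normal_null_root (a b c : R) : a != 0%R ->
  normal_prob 0 1 [set x : R | a * x ^+ 2 + b * x + c = 0]%R = 0.
Proof.
move=> a0; set Z := [set x : R | _].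
suff fZ : finite_set Z.
  have /null_content_dominatesP := @normal_prob_dominates R 0 1.
  apply; first exact: countable_measurable (finite_set_countable fZ).
  exact: countable_lebesgue_measure0 (finite_set_countable fZ).
have [/eqP ->//|/set0P [x Zx]] := boolP (Z == set0).
(* Given one root [x], Vieta's formula for the sum of the roots gives the only other candidate. *)
apply: (@sub_finite_set _ _ [set x; - (b / a) - x]%R).
  move=> y Zy /=; have [->|yx] := eqVneq y x; [by left|right].
  have : ((y - x) * (a * (y + x) + b) = 0)%R.
    rewrite (_ : _ * _ = (a * y ^+ 2 + b * y + c) - (a * x ^+ 2 + b * x + c))%R; last by ring.
    by rewrite Zx Zy subrr.
  move=> /eqP; rewrite mulf_eq0 subr_eq0 (negbTE yx) /= => /eqP h.
  have -> : b = (- (a * (y + x)))%R by apply/eqP; rewrite -subr_eq0 opprK addrC h.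
  by field.
by rewrite finite_setU; split; exact: finite_set1.
Qed.

Lemma gaussian_quadratic_null (A : 'M[R]_q) (r : R) (i : 'I_q) :
  A i i != 0%R ->
  P [set s | ((Y s : 'rV[R]_q) *m A *m (Y s : 'rV[R]_q)^T) 0%R 0%R = r] = 0.
Proof.
move=> Aii.
pose W (v : q.-tuple (measurableTypeR R)) :=
  (\sum_j (\sum_k A k j * tnth v k) * tnth v j)%R.
pose L (v : q.-tuple (measurableTypeR R)) :=
  (\sum_j (A j i + A i j) * tnth v j)%R.
have mW : measurable_fun setT W.
  apply: measurable_sum => j; apply: measurable_funM; last exact: measurable_tnth.
  exact: (measurable_linear_tuple (fun k => A k j) xpredT).
have mL : measurable_fun setT L.
  exact: (measurable_linear_tuple (fun j => A j i + A i j)%R xpredT).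
pose E : set (R * q.-tuple (measurableTypeR R)) :=
  [set u | A i i * u.1 ^+ 2 + L u.2 * u.1 + (W u.2 - r) = 0]%R.
have mE : measurable E.
  rewrite (_ : E = (fun u => A i i * u.1 ^+ 2 + L u.2 * u.1 + (W u.2 - r))%R
      @^-1` [set 0%R])//.
  rewrite -[X in measurable X]setTI.
  have : measurable_fun setT (fun u : R * q.-tuple (measurableTypeR R) =>
      A i i * u.1 ^+ 2 + L u.2 * u.1 + (W u.2 - r))%R.
    apply: measurable_funD; first apply: measurable_funD.
    - by apply: measurable_funM => //; apply: measurable_funX.
    - by apply: measurable_funM => //; exact: measurableT_comp.
    - by apply: measurable_funB => //; exact: measurableT_comp.
  by apply => //; exact: measurable_set1.
have YE s : ((Y s : 'rV[R]_q) *m A *m (Y s : 'rV[R]_q)^T) 0%R 0%R =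
   (A i i * X i s ^+ 2 + L (others X i s) * X i s + W (others X i s))%R.
  pose v : 'rV[R]_q := \row_j tnth (others X i s) j.
  have -> : (Y s : 'rV[R]_q) = (v + X i s *: delta_mx 0%R i)%R.
    apply/rowP => j; rewrite !mxE eqxx /=; have [->|ji] := eqVneq j i.
      by rewrite tnth_mktuple eqxx add0r mulr1.
    by rewrite tnth_others// mulr0 addr0.
  rewrite linearD /= linearZ /= trmx_delta !(mulmxDl, mulmxDr).
  rewrite -!scalemxAl -!scalemxAr -rowE -!colE !mxE.
  have -> : (\sum_j (v *m A) 0 j * v^T j 0 = W (others X i s))%R.
    apply: eq_bigr => j _; rewrite !mxE; congr (_ * _)%R.
    by apply: eq_bigr => k _; rewrite mxE mulrC.
  have -> : (L (others X i s) = \sum_j v 0 j * A j i + \sum_j row i A 0 j * v^T j 0)%R.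
    rewrite -big_split; apply: eq_bigr => j _.
    by rewrite /= !mxE mulrDl [(A j i * _)%R]mulrC.
  by ring.
have -> : [set s | ((Y s : 'rV[R]_q) *m A *m (Y s : 'rV[R]_q)^T) 0%R 0%R = r] =
    (fun s => (X i s, others X i s)) @^-1` E.
  rewrite eqEsubset; split => s; rewrite /E /= YE; first by move=> <-; ring.
  by move=> /eqP; rewrite addrA subr_eq0 => /eqP.
have mXo : measurable_fun setT (fun s => (X i s, others X i s)).
  by apply/measurable_fun_pair => //; exact: measurable_others.
rewrite -(setIT (_ @^-1` _)) -integral_indic//; last first.
  by rewrite -[X in measurable X]setTI; exact: mXo.
transitivity (\int[P]_s (\1_E (X i s, others X i s))%:E); first by [].
rewrite (@integral_gaussian_coord i (fun u => (\1_E u)%:E))//.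
- apply: integral0_eq => s _.
  rewrite -[RHS](normal_null_root (L (others X i s)) (W (others X i s) - r)%R Aii).
  set Z := [set x : R | _].
  rewrite -(setIT Z) -integral_indic//.
  rewrite (_ : Z = (fun x : R => (x, others X i s)) @^-1` E)//.
  rewrite -[X in measurable X]setTI.
  have : measurable_fun setT (fun x : R => (x, others X i s)) by exact: pair2_measurable.
  exact.
- by apply/measurable_EFinP; exact: measurable_indic.
Qed.

End gaussian_vectors.

(** * Extremal eigenvalues and the spectral norm *)

Section quadratic_forms.
Context {R : realType}.

Definition dot n (x y : 'rV[R]_n) : R := (x *m y^T) 0 0.
Definition qform n (A : 'M[R]_n) (x : 'rV[R]_n) : R := (x *m A *m x^T) 0 0.

Lemma dotE n (x y : 'rV[R]_n) : dot x y = \sum_i x 0 i * y 0 i.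
Proof. by rewrite /dot mxE; apply: eq_bigr => i _; rewrite mxE. Qed.

Lemma dotC n (x y : 'rV[R]_n) : dot x y = dot y x.
Proof. by rewrite !dotE; apply: eq_bigr => i _; rewrite mulrC. Qed.

Lemma dotDl n (x y z : 'rV[R]_n) : dot (x + y) z = dot x z + dot y z.
Proof. by rewrite /dot mulmxDl mxE. Qed.

Lemma dotZl n a (x z : 'rV[R]_n) : dot (a *: x) z = a * dot x z.
Proof. by rewrite /dot -scalemxAl mxE. Qed.

Lemma dotDr n (x y z : 'rV[R]_n) : dot z (x + y) = dot z x + dot z y.
Proof. by rewrite dotC dotDl !(dotC z). Qed.

Lemma dotZr n a (x z : 'rV[R]_n) : dot z (a *: x) = a * dot z x.
Proof. by rewrite dotC dotZl (dotC z). Qed.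

Lemma qform_dot n (A : 'M[R]_n) x : qform A x = dot (x *m A) x.
Proof. by []. Qed.

Lemma dot_mulmx n (A : 'M[R]_n) x y : dot (x *m A) y = dot x (y *m A^T).
Proof. by rewrite /dot trmx_mul trmxK mulmxA. Qed.

Lemma qformD n (A B : 'M[R]_n) x : qform (A + B) x = qform A x + qform B x.
Proof. by rewrite /qform mulmxDr mulmxDl mxE. Qed.

Lemma qformN n (A : 'M[R]_n) x : qform (- A) x = - qform A x.
Proof. by rewrite /qform mulmxN mulNmx mxE. Qed.

Lemma qformZ n (A : 'M[R]_n) a x : qform A (a *: x) = a ^+ 2 * qform A x.
Proof. by rewrite !qform_dot -scalemxAl dotZl dotZr mulrA. Qed.

Lemma enorm_ge0 n (x : 'rV[R]_n) : 0 <= enorm x.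
Proof. exact: sqrtr_ge0. Qed.

Lemma sqr_enorm_sum n (x : 'rV[R]_n) : enorm x ^+ 2 = \sum_i x 0 i ^+ 2.
Proof. by rewrite sqr_sqrtr// sumr_ge0// => i _; rewrite sqr_ge0. Qed.

Lemma sqr_enorm n (x : 'rV[R]_n) : enorm x ^+ 2 = dot x x.
Proof. by rewrite sqr_enorm_sum dotE. Qed.

Lemma enorm_eq0 n (x : 'rV[R]_n) : (enorm x == 0) = (x == 0).
Proof.
apply/idP/eqP => [/eqP x0|->]; last first.
  by rewrite -sqrf_eq0 sqr_enorm_sum big1// => i _; rewrite mxE expr0n.
have /eqP := sqr_enorm_sum x; rewrite x0 expr0n eq_sym psumr_eq0.
  move=> /allP h; apply/rowP => i; rewrite mxE; apply/eqP.
  by rewrite -sqrf_eq0; apply: h; rewrite mem_index_enum.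
by move=> i _; rewrite sqr_ge0.
Qed.

Lemma enormZ n a (x : 'rV[R]_n) : enorm (a *: x) = `|a| * enorm x.
Proof.
apply/eqP; rewrite -(@eqrXn2 _ 2)// ?mulr_ge0 ?enorm_ge0//.
by rewrite exprMn !sqr_enorm dotZl dotZr mulrA real_normK ?num_real.
Qed.

Lemma dot_ge0 n (x : 'rV[R]_n) : 0 <= dot x x.
Proof. by rewrite -sqr_enorm sqr_ge0. Qed.

Lemma cauchy_schwarz n (x y : 'rV[R]_n) : `|dot x y| <= enorm x * enorm y.
Proof.
rewrite -(@ler_pXn2r _ 2) ?nnegrE ?mulr_ge0 ?enorm_ge0//.
rewrite real_normK ?num_real// exprMn !sqr_enorm.
have [->|x0] := eqVneq x 0.
  by rewrite {1}/dot mul0mx mxE expr0n mulr_ge0 ?dot_ge0.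
have xx : 0 < dot x x by rewrite lt_neqAle dot_ge0 -sqr_enorm eq_sym sqrf_eq0 enorm_eq0 x0.
(* This vector is [dot x x] times the component of [y] orthogonal to [x]; expanding its square norm
   gives the inequality up to the factor [dot x x]. *)
have := dot_ge0 (dot x x *: y - dot x y *: x).
rewrite !(dotDl, dotDr, dotZl, dotZr) -!scaleNr !(dotZl, dotZr) (dotC y x) => h.
rewrite -subr_ge0 -(pmulr_rge0 _ xx); apply: le_trans h _.
by rewrite le_eqVlt; apply/orP; left; apply/eqP; ring.
Qed.

Lemma continuous_sum n (I : finType) (f : I -> 'rV[R]_n -> R) :
  (forall i, continuous (f i)) -> continuous (fun x => \sum_i f i x).
Proof. by move=> cf; apply: continuous_big => //; exact: add_continuous. Qed.

Lemma continuous_mul n (f g : 'rV[R]_n -> R) :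
  continuous f -> continuous g -> continuous (fun x => f x * g x).
Proof. by move=> cf cg x; exact: (continuousM (cf x) (cg x)). Qed.

Lemma continuous_enorm n : continuous (@enorm R n).
Proof.
have c2 : continuous (fun y : 'rV[R]_n => \sum_i (y 0 i * y 0 i)).
  by apply: continuous_sum => i; apply: continuous_mul => x; exact: coord_continuous.
rewrite (_ : @enorm R n = Num.sqrt \o (fun y => \sum_i (y 0 i * y 0 i))).
  move=> x; apply: continuous_comp; first exact: c2.
  exact: sqrt_continuous.
by apply/funext => y /=; congr Num.sqrt; apply: eq_bigr => i _; rewrite expr2.
Qed.

Lemma continuous_qform n (A : 'M[R]_n) : continuous (qform A).
Proof.
rewrite (_ : qform A = fun x => \sum_j (\sum_k x 0 k * A k j) * x 0 j); last first.
  by apply/funext => x; rewrite /qform mxE; apply: eq_bigr => j _; rewrite !mxE.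
apply: continuous_sum => j; apply: continuous_mul; last by move=> x; exact: coord_continuous.
apply: continuous_sum => k; apply: continuous_mul => x; first exact: coord_continuous.
exact: cst_continuous.
Qed.

Lemma coord_le_enorm n (x : 'rV[R]_n) i : `|x 0 i| <= enorm x.
Proof.
rewrite -(@ler_pXn2r _ 2) ?nnegrE ?enorm_ge0// real_normK ?num_real//.
rewrite sqr_enorm_sum (bigD1 i)//= lerDl sumr_ge0// => j _; exact: sqr_ge0.
Qed.

Lemma compact_sphere n : compact [set x : 'rV[R]_n | enorm x = 1].
Proof.
apply: bounded_closed_compact.
  exists 1; split => // M M1 x /= x1; apply: le_trans (ltW M1).
  rewrite [leLHS]/Num.norm /= mx_normrE; apply/bigmax_leP; split => // -[i j] _ /=.
  by rewrite ord1 -x1 coord_le_enorm.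
rewrite (_ : [set x | _] = (@enorm R n) @^-1` [set 1])//.
by apply: closed_comp => [x _|]; [exact: continuous_enorm|exact: closed_eq].
Qed.

(* a is the minimum of the quadratic form over the unit sphere, attained by
   compactness; first-order optimality makes the minimizer an eigenvector. *)
Lemma rayleigh_min n (A : 'M[R]_n) : (0 < n)%N -> A^T = A ->
  exists2 a, eigenvalue A a & forall x, a * enorm x ^+ 2 <= qform A x.
Proof.
move=> n0 sA.
have S0 : [set x : 'rV[R]_n | enorm x = 1] !=set0.
  exists (delta_mx 0 (Ordinal n0)) => /=.
  rewrite /enorm (bigD1 (Ordinal n0))//= big1 ?addr0 ?mxE ?eqxx ?expr1n ?sqrtr1//.
  by move=> i ni; rewrite mxE (negbTE ni) andbF expr0n.
have [x xS xmin] := EVT_min_rV S0 (@compact_sphere n)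
  (continuous_subspaceT (@continuous_qform n A)).
rewrite inE /= in xS.
(* By homogeneity, minimality on the sphere extends to all vectors. *)
have minA y : qform A x * enorm y ^+ 2 <= qform A y.
  have [->|y0] := eqVneq y 0.
    by rewrite sqr_enorm /dot mul0mx mxE mulr0 /qform !mul0mx mxE.
  have ey : 0 < enorm y by rewrite lt_neqAle enorm_ge0 eq_sym enorm_eq0 y0.
  have := xmin ((enorm y)^-1 *: y); rewrite inE /= qformZ enormZ => h.
  rewrite -ler_pdivlMr ?exprn_gt0// mulrC -exprVn; apply: h.
  by rewrite ger0_norm ?invr_ge0 ?enorm_ge0// mulVf// gt_eqF.
exists (qform A x) => //.
set a := qform A x in minA *.
(* The residual [w] of the eigenvector equation is used as the direction of variation; it is
   orthogonal to [x], since [a] is the value of the form at the unit vector [x]. *)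
have [w wE] : exists w, x *m A = w + a *: x by exists (x *m A - a *: x); rewrite subrK.
suff w0 : w = 0.
  apply/eigenvalueP; exists x; first by rewrite wE w0 add0r.
  by rewrite -enorm_eq0 xS oner_eq0.
pose c := qform A w - a * enorm w ^+ 2.
have key (t : R) : 0 <= 2 * t * enorm w ^+ 2 + t ^+ 2 * c.
  have := minA (x + t *: w); rewrite -subr_ge0.
  have wx : dot (w *m A) x = dot (x *m A) w by rewrite dot_mulmx sA dotC.
  have xw : dot x w = 0.
    have : qform A x = dot w x + a by rewrite qform_dot wE dotDl dotZl -sqr_enorm xS expr1n mulr1.
    by rewrite -/a dotC => /eqP; rewrite -subr_eq0 opprD addrCA subrr addr0 oppr_eq0 => /eqP.
  rewrite !sqr_enorm /c !qform_dot mulmxDl -scalemxAl.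
  rewrite !(dotDl, dotDr, dotZl, dotZr) wx wE !(dotDl, dotZl) (dotC w x) xw.
  rewrite -!sqr_enorm xS => h.
  apply: le_trans h _.
  by rewrite le_eqVlt; apply/orP; left; apply/eqP; ring.
apply/eqP; rewrite -enorm_eq0 -sqrf_eq0; set e := enorm w ^+ 2 in key *.
have e0 : 0 <= e by exact: sqr_ge0.
rewrite eq_le e0 andbT.
have c1 : 0 < `|c| + 1 by rewrite ltr_wpDl.
(* Since [key] holds for all [t], its linear coefficient must vanish. The choice
   [t = - e / (|c| + 1)], with denominators cleared, leaves [e ^+ 2] times a negative number. *)
have : 0 <= (2 * - (e / (`|c| + 1)) * e + (- (e / (`|c| + 1))) ^+ 2 * c) * (`|c| + 1) ^+ 2.
  by rewrite mulr_ge0 ?sqr_ge0 ?key.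
rewrite (_ : _ * _ ^+ 2 = e ^+ 2 * (c - 2 * (`|c| + 1))); last first.
  by field; rewrite gt_eqF.
have cN : c - 2 * (`|c| + 1) < 0.
  by have := ler_norm c; have := normr_ge0 c; lra.
rewrite nmulr_lge0// => e2.
have : e ^+ 2 == 0 by rewrite eq_le e2 sqr_ge0.
by rewrite sqrf_eq0 => /eqP ->.
Qed.

Lemma eigen_ge n (A : 'M[R]_n) a b : eigenvalue A b ->
  (forall x, a * enorm x ^+ 2 <= qform A x) -> a <= b.
Proof.
move=> /eigenvalueP[x xA x0] /(_ x).
rewrite qform_dot xA dotZl -sqr_enorm ler_pM2r// exprn_gt0//.
by rewrite lt_neqAle enorm_ge0 eq_sym enorm_eq0 x0.
Qed.

(** The value given by [rayleigh_min] is both an eigenvalue and a lower bound of all eigenvalues, so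
    the infimum defining [eigmin] is attained. *)
Lemma eigminP n (A : 'M[R]_n) : (0 < n)%N -> A^T = A ->
  eigenvalue A (eigmin A) /\ forall x, eigmin A * enorm x ^+ 2 <= qform A x.
Proof.
move=> n0 sA; have [a aA amin] := rayleigh_min n0 sA.
suff -> : eigmin A = a by [].
apply/eqP; rewrite eq_le; apply/andP; split.
  by apply: ge_inf => //; exists a => b /= bA; exact: eigen_ge amin.
by apply: lb_le_inf; [exists a|move=> b /= bA; exact: eigen_ge amin].
Qed.

Lemma eigenvalueN n (A : 'M[R]_n) a : eigenvalue (- A) a = eigenvalue A (- a).
Proof.
have sub (B : 'M[R]_n) b : eigenvalue B b -> eigenvalue (- B) (- b).
  move=> /eigenvalueP[x xB x0]; apply/eigenvalueP; exists x => //.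
  by rewrite mulmxN xB scaleNr.
by apply/idP/idP => /sub //; rewrite opprK.
Qed.

Lemma eigmaxE n (A : 'M[R]_n) : eigmax A = - eigmin (- A).
Proof.
rewrite /eigmax /eigmin /inf opprK; congr sup; rewrite eqEsubset; split => a /=.
  by move=> aA; exists (- a); rewrite ?opprK//= eigenvalueN opprK.
by move=> [b /= + <-]; rewrite eigenvalueN.
Qed.

Lemma eigmaxP n (A : 'M[R]_n) : (0 < n)%N -> A^T = A ->
  eigenvalue A (eigmax A) /\ forall x, qform A x <= eigmax A * enorm x ^+ 2.
Proof.
move=> n0 sA; have [|aA amin] := @eigminP n (- A) n0; first by rewrite linearN /= sA.
rewrite eigmaxE; split; first by rewrite -eigenvalueN.
by move=> x; rewrite [leRHS]mulNr lerNr -qformN; exact: amin.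
Qed.

Lemma trmx_psd_sqrt n (A : 'M[R]_n) : (psd_sqrt A)^T = psd_sqrt A.
Proof.
rewrite /psd_sqrt; case: xgetP => [B _ [[] //]|_]; exact: trmx0.
Qed.

Lemma enorm_mulmx_le n (A : 'M[R]_n) x :
  enorm (x *m A) <= specnorm A * enorm x.
Proof.
(* The supremum defining [specnorm] is an upper bound only once the set is known to be bounded. Here
   each coordinate of [y *m A] is bounded by the sum of the absolute values in a column of [A]. *)
have [M hM] : exists M, forall y : 'rV[R]_n, enorm y <= 1 -> enorm (y *m A) <= M.
  pose C := \sum_i (\sum_j `|A j i|) ^+ 2.
  exists (Num.sqrt C) => y y1; rewrite ler_wsqrtr//; apply: ler_sum => i _.
  rewrite -real_normK ?num_real// lerXn2r ?nnegrE ?sumr_ge0//.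
  rewrite mxE; apply: le_trans (ler_norm_sum _ _ _) _; apply: ler_sum => j _.
  by rewrite normrM ler_piMl//; exact: le_trans (coord_le_enorm y j) y1.
have [->|x0] := eqVneq x 0.
  have /eqP e0 : enorm (0 : 'rV[R]_n) == 0 by rewrite enorm_eq0.
  by rewrite mul0mx e0 mulr0.
have ex : 0 < enorm x by rewrite lt_neqAle enorm_ge0 eq_sym enorm_eq0 x0.
rewrite -ler_pdivrMr//.
have -> : enorm (x *m A) / enorm x = enorm ((enorm x)^-1 *: x *m A).
  by rewrite -scalemxAl enormZ ger0_norm ?invr_ge0 ?enorm_ge0// mulrC.
apply: ub_le_sup.
  by exists M => _ [y /= y1 <-]; exact: hM.
exists ((enorm x)^-1 *: x) => //=.
by rewrite enormZ ger0_norm ?invr_ge0 ?enorm_ge0// mulVf// gt_eqF.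
Qed.

Lemma qform_ge_specnorm n (A : 'M[R]_n) x :
  - (specnorm A * enorm x ^+ 2) <= qform A x.
Proof.
rewrite lerNl; apply: le_trans (ler_norm _) _; rewrite normrN qform_dot.
apply: le_trans (cauchy_schwarz _ _) _.
by rewrite expr2 mulrA ler_wpM2r ?enorm_ge0// enorm_mulmx_le.
Qed.

(** Weyl's inequality: the form of [D] is at least [- specnorm D] times the square norm, so the
    claim follows by testing on an eigenvector of [A + D]. *)
Lemma eigmin_perturb n (A D : 'M[R]_n) : (0 < n)%N -> A^T = A -> D^T = D ->
  eigmin A - specnorm D <= eigmin (A + D).
Proof.
move=> n0 sA sD.
have [|ev _] := @eigminP n (A + D) n0; first by rewrite linearD /= sA sD.
apply: eigen_ge ev _ => x.
rewrite qformD mulrBl lerD ?qform_ge_specnorm//.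
by have [_ ->] := eigminP n0 sA.
Qed.

End quadratic_forms.

(** * Symmetry of the Hessian *)

Section symmetry_of_second_derivatives.
Context {R : realType} {V : normedModType R}.
Implicit Types (f : V -> R) (x u v : V).

(** Identifies the difference quotients along [v] with those of a function of one real variable, so
    that the mean value theorem becomes applicable. *)
Lemma derive_line f a v (t : R) :
  (fun h : R => h^-1 *: ((f \o shift (a + t *: v)) (h *: v) - f (a + t *: v))) =
  (fun h : R => h^-1 *: (((fun s : R => f (a + s *: v)) \o shift t) (h *: (1 : R))
                         - f (a + t *: v))).
Proof.
apply/funext => h /=; congr (_ *: (f _ - _)).
by rewrite [h *: 1]mulr1 scalerDl addrCA.
Qed.

Lemma is_derive_line f a v (t : R) : differentiable f (a + t *: v) ->
  is_derive t 1 (fun s : R => f (a + s *: v)) ('D_v f (a + t *: v)).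
Proof.
move=> df; have := @diff_derivable _ _ _ f (a + t *: v) v df.
rewrite /derivable derive_line => dl; apply: DeriveDef => //.
by rewrite /derive derive_line.
Qed.

Lemma differentiable_near_bound f x (e : R) : differentiable f x -> 0 < e ->
  exists2 r : R, 0 < r & forall w, `|w| < r ->
    `|f (x + w) - f x - 'd f x w| <= e * `|w|.
Proof.
move=> /diff_locally; rewrite eqaddoP => /(_ e) /[swap] e0 /(_ e0).
move=> /nbhs_norm0P[r r0 h]; exists r => // w wr; have := h w wr.
by rewrite /= /cst !fctE /= (addrC w x) opprD addrA.
Qed.

(* The mean value theorem along v rewrites the second difference as the increment
   of 'D_v f between x + s v and x + h u + s v, for some s in ]0, h[. *)
Lemma second_difference f x u v (e : R) : (\forall y \near x, differentiable f y) ->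
  differentiable (fun y => 'D_v f y) x -> 0 < e ->
  exists2 r : R, 0 < r & forall h, 0 < h < r ->
    `|f (x + h *: u + h *: v) - f (x + h *: u) - f (x + h *: v) + f x
      - h ^+ 2 * 'D_u (fun y => 'D_v f y) x| <= e * h ^+ 2.
Proof.
move=> /nbhs_normP[r1 /= r10 df] dg e0.
(* All increments used have norm at most [h * C]. With relative precision [e / (2 * C)], the two
   first-order remainders add up to at most [e * h], and the mean value theorem supplies another
   factor [h]. *)
pose C := `|u| + `|v| + 1.
have C0 : 0 < C by rewrite ltr_wpDl ?addr_ge0.
have e'0 : 0 < e / (2 * C) by rewrite divr_gt0// mulr_gt0.
have [r2 r20 hr2] := differentiable_near_bound dg e'0.
pose g := fun y => 'D_v f y.
exists (Num.min r1 r2 / C); first by rewrite divr_gt0// lt_min r10.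
move=> h /andP[h0]; rewrite ltr_pdivlMr// lt_min => /andP[hr1 hr2'].
have small (s : R) : 0 <= s <= h -> `|h *: u + s *: v| <= h * C /\ `|s *: v| <= h * C.
  move=> /andP[s0 sh]; rewrite /C !mulrDr mulr1.
  have sv : s * `|v| <= h * `|v| by exact: ler_wpM2r.
  have hu : 0 <= h * `|u| by rewrite mulr_ge0// ltW.
  split; last by rewrite normrZ ger0_norm//; lra.
  by apply: le_trans (ler_normD _ _) _; rewrite !normrZ !ger0_norm// ?ltW//; lra.
pose G (s : R) := f (x + h *: u + s *: v) - f (x + s *: v).
have near_x w : `|w| <= h * C -> differentiable f (x + w).
  by move=> wh; apply: df; rewrite /= opprD addrA subrr sub0r normrN; exact: le_lt_trans hr1.
have dG (s : R) : 0 <= s <= h ->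
    is_derive s 1 G (g (x + h *: u + s *: v) - g (x + s *: v)).
  move=> sh; have [s1 s2] := small s sh; apply: is_deriveB.
    by apply: is_derive_line; rewrite -addrA; exact: near_x.
  by apply: is_derive_line; exact: near_x.
have cG : {within `[0, h], continuous G}.
  apply: derivable_within_continuous => s; rewrite in_itv/= => sh.
  by have [] := dG s sh.
have dG' (s : R) : s \in `]0, h[ -> is_derive s 1 G (g (x + h *: u + s *: v) - g (x + s *: v)).
  by rewrite in_itv/= => /andP[s0 sh]; apply: dG; rewrite !ltW.
have [s /[1!in_itv]/= /andP[s0 sh]] := MVT h0 dG' cG.
have sh' : 0 <= s <= h by rewrite !ltW.
have [s1 s2] := small s sh'.
rewrite /G !scale0r !addr0 subr0 => Gh.
have b1 := hr2 _ (le_lt_trans s1 hr2').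
have b2 := hr2 _ (le_lt_trans s2 hr2').
rewrite (_ : f (x + h *: u + h *: v) - _ - _ + f x =
   (g (x + h *: u + s *: v) - g (x + s *: v)) * h); last by rewrite -Gh; ring.
rewrite (deriveE u dg) -/g.
have dlin : 'd g x (h *: u + s *: v) = h * 'd g x u + 'd g x (s *: v).
  by rewrite linearD linearZ.
rewrite dlin addrA in b1.
rewrite (_ : _ - _ = h * ((g (x + h *: u + s *: v) - g x - (h * 'd g x u + 'd g x (s *: v)))
   - (g (x + s *: v) - g x - 'd g x (s *: v)))); last by ring.
rewrite normrM (ger0_norm (ltW h0)).
rewrite (_ : e * h ^+ 2 = h * (e / (2 * C) * (h * C) + e / (2 * C) * (h * C))); last first.
  by field; rewrite gt_eqF.
rewrite ler_pM2l//; apply: le_trans (ler_normB _ _) _; apply: lerD.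
  by apply: le_trans b1 _; rewrite ler_wpM2l// ltW.
by apply: le_trans b2 _; rewrite ler_wpM2l// ltW.
Qed.

(** The second difference is symmetric in [u] and [v], and divided by [h ^+ 2] it approximates both
    mixed derivatives. *)
Lemma derive_sym f x u v : (\forall y \near x, differentiable f y) ->
  differentiable (fun y => 'D_u f y) x -> differentiable (fun y => 'D_v f y) x ->
  'D_u (fun y => 'D_v f y) x = 'D_v (fun y => 'D_u f y) x.
Proof.
move=> df du dv; apply/eqP; rewrite -subr_eq0 -normr_le0; apply/ler_addgt0Pr => e e0.
rewrite add0r.
have e20 : 0 < e / 2 by rewrite divr_gt0.
have [r1 r10 h1] := second_difference u df dv e20.
have [r2 r20 h2] := second_difference v df du e20.
pose h := Num.min r1 r2 / 2.
have h0 : 0 < h by rewrite divr_gt0// lt_min r10.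
have hm : h < Num.min r1 r2 by rewrite ltr_pdivrMr// ltr_pMr ?ltr1n// lt_min r10.
move: hm; rewrite lt_min => /andP[hr1 hr2].
have := h1 h; rewrite h0 hr1 => /(_ isT) b1.
have := h2 h; rewrite h0 hr2 => /(_ isT) b2.
rewrite (addrAC x) in b2.
have h2p : 0 < h ^+ 2 by exact: exprn_gt0.
rewrite -(ler_pM2l h2p) -[X in X * `|_|](ger0_norm (ltW h2p)) -normrM mulrBr.
set A := 'D_u _ x in b1 *; set B := 'D_v _ x in b2 *.
set p := f (x + h *: u + h *: v) in b1 b2; set a := f (x + h *: u) in b1 b2.
set b := f (x + h *: v) in b1 b2.
rewrite (_ : _ - _ = (p - b - a + f x - h ^+ 2 * B) - (p - a - b + f x - h ^+ 2 * A)); last by ring.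
apply: le_trans (ler_normB _ _) _; apply: le_trans (lerD b2 b1) _.
by rewrite -mulrDl -splitr mulrC.
Qed.

End symmetry_of_second_derivatives.

Lemma hess_sym (R : realType) n (f : 'rV[R]_n -> R) x :
  twice_differentiable f x -> (hess f x)^T = hess f x.
Proof.
move=> [df dg]; apply/matrixP => i j; rewrite !mxE.
have dgi k : differentiable (fun y => 'D_(delta_mx 0 k) f y) x.
  rewrite (_ : (fun y => _) = (fun y : 'rV[R]_n => y 0 k) \o grad f).
    by apply: differentiable_comp => //; exact: differentiable_coord.
  by apply/funext => y /=; rewrite mxE.
exact: derive_sym.
Qed.

(** * Limits of the error terms *)

Section vanishing_error_terms.
Context {R : realType}.

Lemma powR_natN_cvg0 (c : R) : 0 < c -> n%:R `^ (- c) @[n --> \oo] --> (0 : R).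
Proof.
move=> c0; apply/cvgr0Pnorm_le => e e0; near=> n.
rewrite ger0_norm ?powR_ge0// powRN -[e]invrK lef_pV2 ?posrE ?invr_gt0//; last first.
  by rewrite powR_gt0//; near: n; exact: nbhs_infty_gtr.
have -> : e^-1 = (e^-1 `^ c^-1) `^ c.
  by rewrite -powRrM mulVf ?gt_eqF// powRr1// invr_ge0 ltW.
apply: ge0_ler_powR; rewrite ?nnegrE ?powR_ge0 ?ler0n ?(ltW c0)//.
by apply: ltW; near: n; exact: nbhs_infty_gtr.
Unshelve. all: by end_near. Qed.

Lemma ln_le_powR (x a : R) : 0 < x -> 0 < a -> ln x <= x `^ a / a.
Proof.
move=> x0 a0; rewrite ler_pdivlMr// mulrC -ln_powR.
have xa : 0 < x `^ a by exact: powR_gt0.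
rewrite -[in leLHS](subrK 1 (x `^ a)) [X in ln X]addrC.
by apply: le_trans (le_ln1Dx _) _; [lra|lra].
Qed.

Lemma ln_powR_natN_cvg0 (a b : R) : 0 < a -> 0 < b ->
  ln n%:R `^ a * n%:R `^ (- b) @[n --> \oo] --> (0 : R).
Proof.
(* With this exponent, [ln n <= n ^ c / c] raised to the power [a] costs only [n ^ (b / 2)], so a
   factor [n ^ (- b / 2)] remains. *)
move=> a0 b0; pose c := b / (2 * a).
have c0 : 0 < c by rewrite divr_gt0// mulr_gt0.
have h : c^-1 `^ a * n%:R `^ (- (b / 2)) @[n --> \oo] --> (0 : R).
  rewrite -[X in _ --> X](mulr0 (c^-1 `^ a)).
  by apply: cvgM; [exact: cvg_cst|apply: powR_natN_cvg0; rewrite divr_gt0].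
apply: squeeze_cvgr (cvg_cst (0 : R)) h; near=> n.
have n1 : 1 <= n%:R :> R by near: n; exact: nbhs_infty_ger.
have n0 : 0 < n%:R :> R by exact: lt_le_trans n1.
rewrite mulr_ge0 ?powR_ge0//=.
rewrite (_ : - (b / 2) = b / 2 + - b); last by field.
rewrite powRD ?(gt_eqF n0) ?implybT// mulrA ler_wpM2r ?powR_ge0//.
rewrite (_ : b / 2 = c * a); last by rewrite /c; field; rewrite gt_eqF.
rewrite powRrM -powRM ?powR_ge0 ?invr_ge0 ?(ltW c0)//.
apply: ge0_ler_powR; rewrite ?nnegrE ?ln_ge0 ?mulr_ge0 ?powR_ge0 ?invr_ge0 ?(ltW c0) ?(ltW a0)//.
by rewrite mulrC; exact: ln_le_powR.
Unshelve. all: by end_near. Qed.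

Lemma Cterm_cvg0 q (c : R) : @Cterm R q c n @[n --> \oo] --> (0 : R).
Proof.
rewrite -[X in _ --> X](mulr0 (c * q%:R `^ (9 / 4))).
by apply: cvgM; [exact: cvg_cst|apply: powR_natN_cvg0; lra].
Qed.

(** For [q = 1] as for larger [q], the rate is a constant times a positive power of [ln n] times a
    negative power of [n]. *)
Lemma Drate_cvg0 q (lam : nat -> R) L1 (M : 'M[R]_q) :
  Drate lam L1 M n @[n --> \oo] --> (0 : R).
Proof.
have e (k b : R) : 0 < b -> 0 < k -> forall K : R,
    K * ln n%:R `^ k * n%:R `^ (- b) @[n --> \oo] --> (0 : R).
  move=> b0 k0 K.
  have h : K * (ln n%:R `^ k * n%:R `^ (- b)) @[n --> \oo] --> K * 0.
    by apply: cvgM; [exact: cvg_cst|exact: ln_powR_natN_cvg0].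
  rewrite mulr0 in h; apply: cvg_trans h; apply: near_eq_cvg.
  by apply: nearW => n /=; exact: mulrA.
by rewrite /Drate; case: (q == 1%N); apply: e; lra.
Qed.

Lemma Dorder_cvg0 q (K : R) (A : 'M[R]_q) lam L1 (M : 'M[R]_q) c D :
  Dorder K A lam L1 M (@Cterm R q c) D -> (forall n, (0 < n)%N -> 0 <= D n) ->
  D n @[n --> \oo] --> (0 : R).
Proof.
move=> [_ _ _ hD] D0.
have h : K * (Drate lam L1 M n + @Cterm R q c n) @[n --> \oo] --> (0 : R).
  rewrite -[X in _ --> X](mulr0 K) -[X in K * X](addr0 0).
  apply: cvgM; first exact: cvg_cst.
  by apply: cvgD; [exact: Drate_cvg0|exact: Cterm_cvg0].
apply: squeeze_cvgr (cvg_cst (0 : R)) h; near=> n.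
have n1 : (1 < n)%N by near: n; exact: nbhs_infty_gt.
by rewrite D0 ?hD// ltnW.
Unshelve. all: by end_near. Qed.

Lemma Eterm_cvg0 p q d (m : problem R p q d) (eps : R) : 0 < eps ->
  Eterm m eps n @[n --> \oo] --> (0 : R).
Proof.
move=> eps0; rewrite /Eterm; set a := enorm _.
have [_|a0] := eqVneq a 0; first exact: cvg_cst.
have a2 : 0 < a ^+ 2 by rewrite exprn_even_gt0.
pose k := eps ^+ 2 / (2 * a ^+ 2).
have k0 : 0 < k by apply: divr_gt0; [exact: exprn_gt0|exact: mulr_gt0].
apply/cvgr0Pnorm_le => e e0; near=> n.
rewrite ger0_norm ?expR_ge0// -[e]lnK ?posrE// ler_expR lerNl -mulrA -/k.
by rewrite -ler_pdivrMr//; apply: ltW; near: n; exact: nbhs_infty_gtr.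
Unshelve. all: by end_near. Qed.

End vanishing_error_terms.

(** * Comparison of the Gaussian quadratic forms *)

Section real_valued_probability.
Context {R : realType} d (T : measurableType d) (P : probability T R).
Implicit Types A B C : set T.

Lemma le_fine_prob A B : measurable A -> measurable B -> A `<=` B ->
  fine (P A) <= fine (P B).
Proof.
move=> mA mB AB; apply: fine_le; rewrite ?fin_num_measure//.
by apply: le_measure => //; rewrite inE.
Qed.

Lemma fine_prob_union A B C : measurable A -> measurable B -> measurable C ->
  A `<=` B `|` C -> fine (P A) <= fine (P B) + fine (P C).
Proof.
move=> mA mB mC ABC; rewrite -fineD ?fin_num_measure//.
apply: fine_le; rewrite ?fin_numD ?fin_num_measure//.
apply: le_trans (measureU2 _ mB mC).
by apply: le_measure => //; rewrite inE//; exact: measurableU.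
Qed.

End real_valued_probability.

Section estimator_events.
Context {R : realType} {q : nat} d (T : measurableType d).
Variables (Th : set 'rV[R]_q) (th : T -> borel R q).
Hypotheses (oTh : open Th) (mth : measurable_fun setT th) (thTh : forall s, Th (th s)).

(** Continuity on the open set [Th] makes the part of the strict sublevel set inside [Th] open,
    hence Borel. As [th] takes its values in [Th], the event is the complement of its preimage. *)
Lemma measurable_ge_continuous_on (f : 'rV[R]_q -> R) (t : R) :
  (forall x, Th x -> {for x, continuous f}) ->
  measurable [set s | t <= f (th s)].
Proof.
move=> cf; pose U := Th `&` [set x | f x < t].
have oU : open U.
  rewrite openE => x [Thx fx]; apply: filterI; first exact: open_nbhs_nbhs.
  exact: (cvgr_lt _ (cf x Thx)) fx.
rewrite (_ : [set s | _] = ~` (th @^-1` U)).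
  apply: measurableC; rewrite -[X in measurable X]setTI; apply: mth => //.
  exact: sub_sigma_algebra.
rewrite eqEsubset; split => s /=.
  by move=> tf [_] /=; rewrite ltNge tf.
by move=> /not_andP[/(_ (thTh s))//|/negP]; rewrite -leNgt.
Qed.

End estimator_events.

Section gaussian_comparison.
Context {R : realType} {q : nat} d (T : measurableType d) (P : probability T R).
Variable Y : T -> borel R q.
Hypotheses (q0 : (0 < q)%N) (hY : std_gaussian P Y).
Variables A B : 'M[R]_q.
Hypotheses (sA : A^T = A) (sB : B^T = B).

Let half (M : 'M[R]_q) (s : T) := 2^-1 * qform M (Y s).
Let tau1 := eigmin (B - A).
Let tau6 := eigmax A.

Lemma measurable_qform (M : 'M[R]_q) :
  measurable_fun setT (fun s => 2^-1 * qform M (Y s)).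
Proof.
apply: measurable_funM => //.
exact: (measurableT_comp (measurable_rV_continuous (@continuous_qform _ _ M)) hY.1).
Qed.

Lemma measurable_qform_ge (M : 'M[R]_q) a : measurable [set s | a <= half M s].
Proof.
rewrite (_ : [set s | _] = half M @^-1` `[a, +oo[%classic).
  by rewrite -[X in measurable X]setTI; apply: measurable_qform.
by rewrite eqEsubset; split => s /=; rewrite in_itv/= andbT.
Qed.

Lemma measurable_qform_itv (M : 'M[R]_q) a b : measurable [set s | a <= half M s <= b].
Proof.
rewrite (_ : [set s | _] = half M @^-1` `[a, b]%classic).
  by rewrite -[X in measurable X]setTI; apply: measurable_qform.
by rewrite eqEsubset; split => s /=; rewrite in_itv/=.
Qed.

(** Supplies the diagonal entry required by [gaussian_quadratic_null]. If the diagonal vanished, the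
    values of the form at the sum and difference of two basis vectors would be opposite multiples of
    [M i j], forcing [M = 0]. *)
Lemma psd_diag_neq0 (M : 'M[R]_q) y : M^T = M -> (forall x, 0 <= qform M x) ->
  0 < qform M y -> exists i, M i i != 0.
Proof.
move=> sM M0 My; apply: contrapT => /forallNP h.
have d0 i : M i i = 0 by apply/eqP/negPn/negP; exact: h.
suff M00 : M = 0 by move: My; rewrite M00 /qform mulmx0 mul0mx mxE ltxx.
apply/matrixP => i j; rewrite mxE.
have e a b k l : dot (a *: delta_mx 0 k *m M) (b *: delta_mx 0 l : 'rV_q) = a * b * M k l.
  rewrite -scalemxAl dotZl dotZr mulrA; congr (_ * _).
  by rewrite /dot trmx_delta -rowE -colE !mxE.
have k a : qform M (1 *: delta_mx 0 i + a *: delta_mx 0 j) = 2 * a * M i j.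
  rewrite qform_dot mulmxDl !(dotDl, dotDr) !e !d0.
  have -> : M j i = M i j by rewrite -{1}sM mxE.
  by ring.
have := M0 (1 *: delta_mx 0 i + 1 *: delta_mx 0 j).
have := M0 (1 *: delta_mx 0 i + (-1) *: delta_mx 0 j).
by rewrite !k => h1 h2; lra.
Qed.

(** The form of [B - A] is at least [tau1] times the square norm, which is itself at least the form
    of [A] divided by [tau6]. *)
Lemma qform_le_ratio x : 0 <= tau1 -> 0 < tau6 ->
  (1 + tau1 / tau6) * qform A x <= qform B x.
Proof.
move=> t1 t6.
have sBA : (B - A)^T = B - A by rewrite linearB /= sA sB.
have [_ /(_ x) hB] := eigminP q0 sBA.
have [_ /(_ x) hA] := eigmaxP q0 sA.
rewrite qformD qformN -/tau1 in hB; rewrite -/tau6 in hA.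
have : tau1 / tau6 * qform A x <= tau1 * enorm x ^+ 2.
  rewrite mulrAC ler_pdivrMr// -mulrA ler_wpM2l//.
  by rewrite [leRHS]mulrC.
by move=> h; lra.
Qed.

Lemma gaussian_comparison (s u : R) : 0 <= tau1 -> 0 < tau6 ->
  (forall x, 0 <= qform A x) -> u <= (1 + tau1 / tau6) * s ->
  fine (P [set w | s <= half A w]) - fine (P [set w | u <= half B w]) <=
  - fine (P [set w | u <= half B w <= (1 + tau1 / tau6) * s]).
Proof.
move=> t1 t6 A0 us; set r := (1 + tau1 / tau6) * s in us *.
have c0 : 0 < 1 + tau1 / tau6 by rewrite ltr_wpDr// divr_ge0// ltW.
have B0 x : 0 <= qform B x.
  by apply: le_trans (qform_le_ratio x t1 t6); rewrite mulr_ge0// ltW.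
(* An eigenvector of [A] for [tau6 > 0] has a positive value under [A], hence under [B]. *)
have [i Bii] : exists i, B i i != 0.
  have [/eigenvalueP[y yA y0] _] := eigmaxP q0 sA.
  apply: (@psd_diag_neq0 _ y) => //; apply: lt_le_trans (qform_le_ratio y t1 t6).
  have ey : 0 < enorm y by rewrite lt_neqAle enorm_ge0 eq_sym enorm_eq0 y0.
  rewrite qform_dot yA dotZl -sqr_enorm.
  by apply: mulr_gt0 => //; apply: mulr_gt0 => //; exact: exprn_gt0.
have null : fine (P [set w | half B w = r]) = 0.
  have := gaussian_quadratic_null hY (r * 2) Bii.
  rewrite (_ : [set w | _] = [set w | half B w = r]); first by move=> ->.
  rewrite eqEsubset; split => w; rewrite /half /qform /=; first by move=> ->; field.
  by move=> <-; field.
have mnull : measurable [set w | half B w = r].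
  rewrite (_ : [set w | _] = [set w | r <= half B w <= r]); first exact: measurable_qform_itv.
  rewrite eqEsubset; split => w /=; first by move=> ->; rewrite lexx.
  by move=> h; apply/eqP; rewrite eq_le andbC.
have mlt : measurable [set w | u <= half B w < r].
  rewrite (_ : [set s | _] = half B @^-1` `[u, r[%classic).
    by rewrite -[X in measurable X]setTI; apply: measurable_qform.
  by rewrite eqEsubset; split => w /=; rewrite in_itv/=.
have le1 : fine (P [set w | s <= half A w]) <= fine (P [set w | r <= half B w]).
  apply: le_fine_prob; [exact: measurable_qform_ge|exact: measurable_qform_ge|].
  move=> w /= sw; rewrite /half mulrC ler_pdivlMr//.
  apply: le_trans (qform_le_ratio (Y w) t1 t6).
  rewrite /r -mulrA ler_pM2l// -ler_pdivlMr// mulrC; exact: sw.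
have le2 : fine (P [set w | u <= half B w < r]) + fine (P [set w | r <= half B w])
    = fine (P [set w | u <= half B w]).
  rewrite -fineD ?fin_num_measure//; last exact: measurable_qform_ge.
  rewrite -measureU//; [|exact: measurable_qform_ge|]; last first.
    by rewrite -subset0 => w /= [/andP[_]]; rewrite ltNge => /negP.
  congr (fine (P _)); rewrite eqEsubset; split => w /=.
    by move=> [/andP[]//|]; exact: le_trans.
  by move=> uw; rewrite uw /=; have [?|?] := ltP (half B w) r; [left|right].
have le3 : fine (P [set w | u <= half B w <= r]) <=
    fine (P [set w | u <= half B w < r]) + fine (P [set w | half B w = r]).
  apply: fine_prob_union => //; first exact: measurable_qform_itv.
  move=> w /= /andP[-> /=]; rewrite le_eqVlt => /orP[/eqP ->|->]; [by right|by left].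
by lra.
Qed.

End gaussian_comparison.

(** * Sign information from the factored characteristic polynomial *)

Section spectrum.
Context {R : realType} {q : nat}.
Variables (A : 'M[R]_q) (lam : nat -> R).
Hypotheses (q0 : (0 < q)%N) (sA : A^T = A) (hlam : eigenvalues_of (2^-1 *: A) lam).
Hypothesis lam0 : forall i, (0 < i <= q)%N -> 0 <= lam i.

Lemma eigenvalue_half_lam a :
  eigenvalue (2^-1 *: A) a = (a \in map lam (index_iota 1 q.+1)).
Proof.
rewrite eigenvalue_root_char hlam.
by rewrite -(big_map lam xpredT (fun b => 'X - b%:P)) root_prod_XsubC.
Qed.

(** The factor 2 appears because [lam] lists the eigenvalues of the halved matrix. *)
Lemma eigenvalue_lam a : eigenvalue A a ->
  exists2 i, (0 < i <= q)%N & a = 2 * lam i.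
Proof.
move=> /eigenvalueP[x xA x0].
have : eigenvalue (2^-1 *: A) (2^-1 * a).
  by apply/eigenvalueP; exists x => //; rewrite -scalemxAr xA scalerA.
rewrite eigenvalue_half_lam => /mapP[i]; rewrite mem_index_iota ltnS => iq e.
by exists i => //; rewrite -e mulVKf.
Qed.

Lemma lam_eigenvalue i : (0 < i <= q)%N -> eigenvalue A (2 * lam i).
Proof.
move=> iq.
have : eigenvalue (2^-1 *: A) (lam i).
  by rewrite eigenvalue_half_lam map_f// mem_index_iota ltnS.
move=> /eigenvalueP[x xA x0]; apply/eigenvalueP; exists x => //.
by rewrite -scalerA -xA -scalemxAr scalerA divff ?scale1r.
Qed.

Lemma qform_ge0_lam x : 0 <= qform A x.
Proof.
have [/eigenvalue_lam[i iq e] /(_ x)] := eigminP q0 sA.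
by apply: le_trans; rewrite mulr_ge0 ?sqr_ge0// e mulr_ge0// lam0.
Qed.

(** If all [lam i] were 0, [rate_base] would vanish. A positive one yields a positive eigenvalue of
    [A], which makes division by [tau6] meaningful. *)
Lemma eigmax_gt0_lam : 0 < @rate_base R q lam -> 0 < eigmax A.
Proof.
move=> rb.
have [i iq li] : exists2 i, (0 < i <= q)%N & 0 < lam i.
  apply: contrapT => h.
  have l0 i : (0 < i <= q)%N -> lam i = 0.
    move=> iq; apply/eqP; rewrite eq_le lam0// andbT leNgt; apply/negP => li.
    by apply: h; exists i.
  move: rb; rewrite /rate_base; case: ifPn => [/eqP q1|_].
    by rewrite l0 ?q1// ltxx.
  rewrite big_nat big1 ?mul0r ?ltxx// => i iq; rewrite l0 ?expr0n//.
have /eigenvalueP[x xA x0] := lam_eigenvalue iq.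
have [_ /(_ x)] := eigmaxP q0 sA.
rewrite qform_dot xA dotZl -sqr_enorm ler_pM2r.
  by apply: lt_le_trans; rewrite mulr_gt0.
by rewrite exprn_gt0// lt_neqAle enorm_ge0 eq_sym enorm_eq0 x0.
Qed.

End spectrum.

(** * First-order optimality *)

Section gradients.
Context {R : realType} {q : nat}.

Lemma differentialE (f : 'rV[R]_q -> R) x w : differentiable f x ->
  'd f x w = dot (grad f x) w.
Proof.
move=> df; rewrite {1}[w]row_sum_delta linear_sum dotE.
by apply: eq_bigr => i _; rewrite linearZ /= mxE deriveE// mulrC.
Qed.

Lemma grad_argmin (Th : set 'rV[R]_q) (f : 'rV[R]_q -> R) x :
  open Th -> Th x -> differentiable f x -> (forall y, Th y -> f x <= f y) ->
  grad f x = 0.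
Proof.
move=> oTh Thx df fmin.
have /nbhs_normP[r1 /= r10 hr1] : nbhs x Th by exact: open_nbhs_nbhs.
(* For small [h] the increment along [h *: w] is nonnegative while the remainder is at most [h * e],
   so the differential is at least [- e]. Taking [w] opposite to the gradient then forces the
   gradient to vanish. *)
have pos w : 0 <= 'd f x w.
  apply/ler_addgt0Pr => e e0.
  have C0 : 0 < `|w| + 1 by rewrite ltr_wpDl.
  have [r2 r20 hr2] := differentiable_near_bound df (divr_gt0 e0 C0).
  pose h := Num.min r1 r2 / (2 * (`|w| + 1)).
  have m0 : 0 < Num.min r1 r2 by rewrite lt_min r10.
  have h0 : 0 < h by rewrite divr_gt0// mulr_gt0.
  have hw : `|h *: w| < Num.min r1 r2.
    rewrite normrZ ger0_norm ?ltW// /h mulrAC ltr_pdivrMr ?mulr_gt0// ltr_pM2l//.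
    by have := normr_ge0 w; lra.
  move: hw; rewrite lt_min => /andP[hw1 hw2].
  have fx : f x <= f (x + h *: w).
    by apply: fmin; apply: hr1; rewrite /= opprD addrA subrr sub0r normrN.
  have := hr2 _ hw2; rewrite linearZ /= ler_norml => /andP[_ b].
  rewrite -(pmulr_rge0 _ h0) mulrDr.
  have : e / (`|w| + 1) * `|h *: w| <= h * e.
    rewrite normrZ ger0_norm ?(ltW h0)// mulrCA ler_pM2l// mulrAC ler_pdivrMr// ler_pM2l//.
    by rewrite lerDl.
  move: b; rewrite -[h *: 'd f x w]/(h * 'd f x w).
  by move=> b c; lra.
apply/eqP; rewrite -enorm_eq0 -sqrf_eq0 sqr_enorm -differentialE//.
rewrite eq_le pos andbT.
by have := pos (- grad f x); rewrite linearN oppr_ge0.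
Qed.

End gradients.

(** * Half-spaces and the Gaussian tail of the linear term *)

Section halfspaces.
Context {R : realType} {q : nat}.

Lemma convex_halfspace (g : 'rV[R]_q) (c : R) :
  convex_set ([set x : 'rV[R]_q | c <= dot g x] : set (convex_lmodType 'rV[R]_q)).
Proof.
move=> x y l; rewrite !in_setE /= => cx cy.
have -> : conv l x y = (l%:num *: (x : 'rV[R]_q) + (1 - l%:num) *: (y : 'rV[R]_q)) by [].
rewrite dotDr !dotZr.
have l0 : 0 <= l%:num by [].
have l1 : 0 <= 1 - l%:num by rewrite subr_ge0.
rewrite (_ : c = l%:num * c + (1 - l%:num) * c); last by ring.
by apply: lerD; exact: ler_wpM2l.
Qed.

Lemma continuous_dot (g : 'rV[R]_q) : continuous (dot g).
Proof.
rewrite (_ : dot g = fun y => \sum_i g 0 i * y 0 i).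
  apply: continuous_sum => i; apply: continuous_mul => x; first exact: cst_continuous.
  exact: coord_continuous.
by apply/funext => y; rewrite dotE.
Qed.

Lemma measurable_halfspace (g : 'rV[R]_q) (c : R) :
  measurable ([set x : 'rV[R]_q | c <= dot g x] : set (borel R q)).
Proof.
rewrite (_ : [set x | _] = ~` [set x : 'rV[R]_q | dot g x < c]).
  apply: measurableC; apply: sub_sigma_algebra.
  rewrite (_ : mkset _ = dot g @^-1` `]-oo, c[%classic).
    apply: open_comp; last exact: lray_open.
    by move=> x _; exact: continuous_dot.
  by rewrite eqEsubset; split => x /=; rewrite in_itv.
by rewrite eqEsubset; split => x /=; [rewrite ltNge => ->|move/negP; rewrite -leNgt].
Qed.

End halfspaces.

(** By symmetry of [M] this is the linear form with coefficients [g *m M], to which the Chernoff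
    bound applies. If they vanish, the event is empty because [c > 0], in accordance with the
    convention of [Eterm]. *)
Lemma gaussian_halfspace_tail (R : realType) q d (T : measurableType d)
    (P : probability T R) (Y : T -> borel R q) (g : 'rV[R]_q) (M : 'M[R]_q) (c : R) :
  std_gaussian P Y -> M^T = M -> 0 < c ->
  fine (P [set w | c <= dot g ((Y w : 'rV[R]_q) *m M)]) <=
  if enorm (g *m M) == 0 then 0 else expR (- (c ^+ 2 / (2 * enorm (g *m M) ^+ 2))).
Proof.
move=> hY sM c0.
have -> : [set w | c <= dot g ((Y w : 'rV[R]_q) *m M)] =
    [set w | c <= \sum_i (g *m M) 0 i * (Y w : 'rV[R]_q) 0 i].
  have e w : dot g ((Y w : 'rV[R]_q) *m M) = \sum_i (g *m M) 0 i * (Y w : 'rV[R]_q) 0 i.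
    by rewrite -dotE dot_mulmx sM.
  by rewrite eqEsubset; split => w /=; rewrite e.
case: ifPn => [|a0].
  rewrite enorm_eq0 => /eqP ->; rewrite (_ : [set w | _] = set0) ?measure0//.
  rewrite -subset0 => w /=; rewrite big1 ?leNgt ?c0// => i _.
  by rewrite mxE mul0r.
have a2 : 0 < \sum_i (g *m M) 0 i ^+ 2.
  by rewrite -sqr_enorm_sum exprn_gt0// lt_neqAle enorm_ge0 eq_sym a0.
rewrite sqr_enorm_sum -lee_fin fineK; first exact: gaussian_linear_tail (ltW c0) a2.
rewrite fin_num_measure//.
rewrite (_ : [set w | _] = (fun w => \sum_i (g *m M) 0 i * (Y w : 'rV[R]_q) 0 i)
    @^-1` `[c, +oo[%classic).
  by rewrite -[X in measurable X]setTI; apply: (measurable_gaussian_linear hY).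
by rewrite eqEsubset; split => w /=; rewrite in_itv/= andbT.
Qed.

(** * Auxiliary facts for the final assembly *)

Section symmetric_matrices.
Context {R : realType} {q : nat}.

Lemma trmx_curv (M H : 'M[R]_q) : M^T = M -> H^T = H -> (M *m H *m M)^T = M *m H *m M.
Proof. by move=> sM sH; rewrite !trmx_mul sM sH mulmxA. Qed.

Lemma trmx_sub (A B : 'M[R]_q) : A^T = A -> B^T = B -> (A - B)^T = A - B.
Proof. by move=> sA sB; rewrite linearB /= sA sB. Qed.

Lemma trmx_sandwich (H V : 'M[R]_q) : (sandwich H V)^T = sandwich H V.
Proof. exact: trmx_psd_sqrt. Qed.

End symmetric_matrices.

(** Serves the measurability of both events in the split of the ETO regret: the second-order
    remainder, and, with [f] equal to zero, the linear term. *)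
Lemma continuous_linearization (R : realType) q (f : 'rV[R]_q -> R) (g K x : 'rV[R]_q)
    (N c : R) : {for x, continuous f} ->
  {for x, continuous (fun y => N * (f y - c - dot g (y - K)))}.
Proof.
move=> cf.
have cg : {for x, continuous (fun y : 'rV[R]_q => dot g (y - K))}.
  have -> : (fun y : 'rV[R]_q => dot g (y - K)) = (fun y => dot g y + dot g (- K)).
    by apply/funext => y; rewrite dotDr.
  by apply: continuousD; [exact: continuous_dot|exact: cst_continuous].
apply: continuousM; first exact: cst_continuous.
by do 2?apply: continuousB => //; exact: cst_continuous.
Qed.

(** Clearing denominators, the bound on [e] says that [(tau1 + tau6) * (d + e) < tau1 * (t - k)],
    which puts the end points of the interval in the right order. *)
Lemma threshold_le (R : realFieldType) (tau1 tau6 t k d e N : R) :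
  0 <= tau1 -> 0 < tau6 -> 0 < N -> e < tau1 / (tau1 + tau6) * (t - k) - d ->
  N * t - N * k <= (1 + tau1 / tau6) * (N * t - N * k - N * d - N * e).
Proof.
move=> t1 t6 N0 he; have t16 : 0 < tau1 + tau6 by rewrite ltr_wpDl.
have -> : 1 + tau1 / tau6 = (tau1 + tau6) / tau6 by field; rewrite gt_eqF.
rewrite mulrAC ler_pdivlMr// -!mulrBr -mulrA [leRHS]mulrCA ler_pM2l//.
move: he; rewrite mulrAC -(ltrD2r d) subrK ltr_pdivlMr// => he; lra.
Qed.

(** Here [a] stands for the tail of the second-order term, [b] for that of its Gaussian limit, [h]
    for the half-space probability and [u] for the Gaussian IEO tail. *)
Lemma combine_bounds (R : realFieldType) (pE pI a h b u g D E C I : R) :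
  pE <= a + h -> a <= b + D -> h <= E + C -> b - u <= - g -> u - I <= pI ->
  pE - pI <= - g + D + I + C + E.
Proof. lra. Qed.

Lemma combine_bounds0 (R : realFieldType) (pE pI b u g D I : R) :
  pE <= b + D -> b - u <= - g -> u - I <= pI -> pE - pI <= - g + D + I.
Proof. lra. Qed.

(** * Assembly of the tail comparisons *)

Theorem theorem5 (R : realType)
  (* constants of the error terms: C depends only on the regularity constants,
     and the constants hidden in the order of D do not depend on n and q *)
  (CETO CIEO : reg_constants R -> R) (KETO KIEO : R)
  (p q d : nat) (hq : (0 < q)%N)
  (nu : {measure set (borel R d) -> \bar R}) (hnu : is_lebesgue nu)
  (m : problem R p q d) (hm : setup m nu)
  (* data z 0, z 1, ... and estimators computed from the first n of them *)
  (dS : measure_display) (S : measurableType dS) (Pr : probability S R)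
  (z : nat -> S -> borel R d) (hz : iid Pr (truth m) z)
  (hzZ : forall i s, Zset m (z i s))
  (thETO thIEO : nat -> S -> borel R q)
  (hthETO : ETO_estimator m z thETO) (hthIEO : IEO_estimator m z thIEO)
  (* the Gaussian vector Y_0 *)
  (dS' : measure_display) (S' : measurableType dS') (PrY : probability S' R)
  (Y : S' -> borel R q) (hY : std_gaussian PrY Y)
  (* the assumptions *)
  (B0 : R) (hB0 : misspecification m B0)
  (L1 : R) (hL1 : lipschitz_hessian m L1)
  (hcETO : ETO_consistency m Pr z) (hcIEO : IEO_consistency m Pr z)
  (kETO kIEO : reg_constants R)
  (hrETO : ETO_regular m kETO) (hrIEO : IEO_regular m kIEO)
  (hsmooth : smooth_interchange m nu)
  (* the error terms C *)
  (hCETO0 : 0 < CETO kETO) (hCIEO0 : 0 < CIEO kIEO)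
  (hCETO : normal_approx Pr PrY Y thETO (thKL m) (M1ETO m)
     (@Cterm R q (CETO kETO)))
  (hCIEO : normal_approx Pr PrY Y thIEO (thstar m) (M1IEO m)
     (@Cterm R q (CIEO kIEO)))
  (* the error terms D *)
  (DETO DIEO : nat -> R)
  (hDETO : ETO_bound m Pr PrY Y thETO DETO) (hDIEO : IEO_bound m Pr PrY Y thIEO DIEO)
  (lamETO lamIEO : nat -> R)
  (hoETO : Dorder KETO (2^-1 *: curvETO m) lamETO L1 (M1ETO m)
     (@Cterm R q (CETO kETO)) DETO)
  (hoIEO : Dorder KIEO (2^-1 *: curvIEO m) lamIEO L1 (M1IEO m)
     (@Cterm R q (CIEO kIEO)) DIEO) :
  let probR (th : nat -> S -> borel R q) (n : nat) (t : R) :=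
    fine (Pr [set s | t <= regret m (wopt m (th n s))]) in
  let probG (a b : R) := fine (PrY [set s | a <= GIEO m (Y s) <= b]) in
  (forall Cmis : R, 0 < Cmis -> specnorm (Deltamx m) <= Cmis * B0 ->
     B0 <= tau3 m / Cmis -> 0 <= tau1 m)
  /\
  (0 <= tau1 m ->
   [/\ (* Case 1 *)
       (forall n : nat, (0 < n)%N -> forall t : R, t <= kappaIEO m ->
          probR thETO n t - probR thIEO n t = 0),
       (* Case 2 *)
       (forall n : nat, (0 < n)%N -> forall t : R,
          kappaIEO m + (tau6 m + tau1 m) / tau1 m * delta m < t ->
          forall eps : R, 0 < eps ->
          eps < tau1 m / (tau1 m + tau6 m) * (t - kappaIEO m) - delta m ->
          probR thETO n t - probR thIEO n t <=
            - probG (n%:R * t - n%:R * kappaIEO m)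
                    ((1 + tau1 m / tau6 m) *
                       (n%:R * t - n%:R * kappaIEO m - n%:R * delta m - n%:R * eps))
            + DETO n + DIEO n + @Cterm R q (CETO kETO) n + Eterm m eps n),
       (* the case delta = 0 *)
       (delta m = 0 -> forall n : nat, (0 < n)%N -> forall t : R, kappaIEO m < t ->
          probR thETO n t - probR thIEO n t <=
            - probG (n%:R * t - n%:R * kappaIEO m)
                    ((1 + tau1 m / tau6 m) * (n%:R * t - n%:R * kappaIEO m))
            + DETO n + DIEO n) &
       (* the error terms vanish asymptotically *)
       [/\ DETO n @[n --> \oo] --> (0 : R), DIEO n @[n --> \oo] --> (0 : R),
           @Cterm R q (CETO kETO) n @[n --> \oo] --> (0 : R) &
           forall eps : R, 0 < eps -> Eterm m eps n @[n --> \oo] --> (0 : R)]]).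

Proof.
move=> probR probG.
have [[_ oTh _ _] [_ [[_ wsmin] wO [ThKL _] [Thst stmin]]]] := hm.
have [_ td _] := hL1.
have dv th : Theta m th -> differentiable (v0w m) th.
  by move=> /td[/nbhs_singleton].
have cv th : Theta m th -> {for th, continuous (v0w m)}.
  by move=> /dv/differentiable_continuous.
have sKL : (hess_v0 m (thKL m))^T = hess_v0 m (thKL m) by apply: hess_sym; exact: td.
have sst : (hess_v0 m (thstar m))^T = hess_v0 m (thstar m) by apply: hess_sym; exact: td.
have sA : (curvETO m)^T = curvETO m by apply: trmx_curv => //; exact: trmx_sandwich.
have sB : (curvIEO m)^T = curvIEO m by apply: trmx_curv => //; exact: trmx_sandwich.
split.
  (* The difference of the curvature matrices is [Smx + Deltamx], and by Weyl's inequality its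
     smallest eigenvalue is at least [tau3] minus the norm of [Deltamx], which is at most
     [Cmis * B0 <= tau3]. *)
  move=> Cmis C0 hD hB.
  have sS : (Smx m)^T = Smx m.
    by apply: trmx_sub; apply: trmx_curv => //; exact: trmx_sandwich.
  have sD : (Deltamx m)^T = Deltamx m by exact: (trmx_sub (trmx_sub sB sA) sS).
  have -> : tau1 m = eigmin (Smx m + Deltamx m).
    by rewrite /tau1 /Deltamx [in RHS]addrC [in RHS]subrK.
  apply: le_trans (eigmin_perturb hq sS sD).
  rewrite subr_ge0; apply: le_trans hD _.
  by move: hB; rewrite ler_pdivlMr// mulrC.
move=> t1.
have [hlam lam0 rb _] := hoETO.
have A0 x : 0 <= qform (curvETO m) x by exact: (qform_ge0_lam hq sA hlam lam0).
have t6 : 0 < tau6 m by exact: (eigmax_gt0_lam hq sA hlam lam0 rb).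
have delta0 : 0 <= delta m.
  rewrite /delta /kappaETO /kappaIEO opprB addrA subrK subr_ge0; exact: stmin.
have thE n : (0 < n)%N -> measurable_fun setT (thETO n) /\ forall s, Theta m (thETO n s).
  by move=> /hthETO[? h]; split=> // s; have [] := h s.
have thI n : (0 < n)%N -> measurable_fun setT (thIEO n) /\ forall s, Theta m (thIEO n s).
  by move=> /hthIEO[? h]; split=> // s; have [] := h s.
have mreg (th : nat -> S -> borel R q) n (t : R) :
    measurable_fun setT (th n) -> (forall s, Theta m (th n s)) ->
    measurable [set s : S | t <= regret m (wopt m (th n s))].
  move=> mth thTh; rewrite (_ : [set s | _] = [set s | t + v0 m (wstar m) <= v0w m (th n s)]).
    by apply: (measurable_ge_continuous_on oTh mth thTh) => x; exact: cv.
  by rewrite eqEsubset; split => s /=; rewrite /regret lerBrDr.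
have regE n (t : R) th : (0 < n)%N -> (t <= regret m (wopt m th)) =
    (n%:R * t - n%:R * kappaIEO m <= n%:R * (v0w m th - v0w m (thstar m))).
  move=> n0; rewrite -mulrBr ler_pM2l ?ltr0n//.
  by rewrite /kappaIEO opprB addrA lerBlDr subrK lerBrDr.
have probIEO n (t : R) : (0 < n)%N -> kappaIEO m < t ->
    fine (PrY [set w | n%:R * t - n%:R * kappaIEO m <= GIEO m (Y w)]) - DIEO n
    <= probR thIEO n t.
  move=> n0 kt; have n0' : (0 : R) < n%:R by rewrite ltr0n.
  have u0 : 0 < n%:R * t - n%:R * kappaIEO m by rewrite -mulrBr mulr_gt0// subr_gt0.
  have := hDIEO n n0 _ u0; rewrite distrC => /ler_normlW.
  rewrite lerBlDr -lerBlDl => /le_trans; apply.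
  rewrite le_eqVlt; apply/orP; left; apply/eqP; congr (fine (Pr _)).
  by apply/funext => s; rewrite /mkset (regE n).
split.
(* No parameter in [Theta] has regret below [kappaIEO], so both events are the whole space. *)
- move=> n n0 t tk.
  have all (th : S -> borel R q) : (forall s, Theta m (th s)) ->
      [set s : S | t <= regret m (wopt m (th s))] = setT.
    move=> thTh; rewrite -subTset => s _ /=; apply: le_trans tk _.
    by rewrite /kappaIEO /regret lerD2r; exact: stmin.
  by rewrite /probR !all ?subrr//; [exact: (thI n n0).2|exact: (thE n n0).2].
- move=> n n0 t _ eps eps0.
  set rho := tau1 m / (tau1 m + tau6 m) => heps.
  have n0' : (0 : R) < n%:R by rewrite ltr0n.
  have t16 : 0 < tau1 m + tau6 m by rewrite ltr_wpDl.
  (* Since [rho] lies between 0 and 1, the chain [0 < eps + delta < rho * (t - kappaIEO)] yields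
     both [kappaIEO < t] and [0 < s]. *)
  have rho0 : 0 <= rho by rewrite divr_ge0// ltW.
  have rho1 : rho < 1 by rewrite ltr_pdivrMr// mul1r ltrDl.
  have kt : kappaIEO m < t by rewrite -subr_gt0; nra.
  set s := n%:R * t - _ - _ - _.
  have sE : s = n%:R * (t - kappaIEO m - delta m - eps) by rewrite /s; ring.
  have s0 : 0 < s by rewrite sE mulr_gt0//; nra.
  have us : n%:R * t - n%:R * kappaIEO m <= (1 + tau1 m / tau6 m) * s.
    exact: threshold_le.
  have e1 : kappaIEO m + delta m = v0w m (thKL m) - v0 m (wstar m).
    by rewrite /delta addrC subrK.
  have cmp : fine (PrY [set w | s <= GETO m (Y w)])
      - fine (PrY [set w | n%:R * t - n%:R * kappaIEO m <= GIEO m (Y w)])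
      <= - probG (n%:R * t - n%:R * kappaIEO m) ((1 + tau1 m / tau6 m) * s).
    exact: (gaussian_comparison hq hY sA sB t1 t6 A0 us).
  have [mE ThE] := thE n n0.
  have hI := probIEO n t n0 kt.
  pose g := grad (v0w m) (thKL m).
  (* [X] is the second-order remainder scaled by [n]. The event that the linear term is at least
     [eps] becomes, for the estimator error scaled by the square root of [n], the half-space [H];
     its threshold is the source of [n * eps ^ 2] in [Eterm]. *)
  pose X w := n%:R * (v0w m (thETO n w) - v0w m (thKL m) - dot g ((thETO n w : 'rV[R]_q) - thKL m)).
  pose H : set (borel R q) := [set x : 'rV[R]_q | Num.sqrt n%:R * eps <= dot g x].
  have hX : fine (Pr [set w | s <= X w]) <= fine (PrY [set w | s <= GETO m (Y w)]) + DETO n.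
    by have := hDETO n n0 s s0 => /ler_normlW; rewrite lerBlDl.
  have hH : fine (Pr [set w | H (Num.sqrt n%:R *: ((thETO n w : 'rV[R]_q) - thKL m))]) <=
      Eterm m eps n + @Cterm R q (CETO kETO) n.
    have := hCETO n n0 H (measurable_halfspace _ _) (@convex_halfspace _ _ _ _).
    move=> /ler_normlW; rewrite lerBlDl => /le_trans; apply; rewrite lerD2r.
    have := gaussian_halfspace_tail g hY (trmx_sandwich _ _ : (M1ETO m)^T = M1ETO m).
    move=> /(_ (Num.sqrt n%:R * eps)); rewrite mulr_gt0 ?sqrtr_gt0// => /(_ isT).
    by rewrite exprMn sqr_sqrtr ?ler0n.
  have hE : probR thETO n t <= fine (Pr [set w | s <= X w]) +
     fine (Pr [set w | H (Num.sqrt n%:R *: ((thETO n w : 'rV[R]_q) - thKL m))]).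
    apply: fine_prob_union.
    + exact: mreg.
    + apply: (@measurable_ge_continuous_on _ _ _ _ _ _ oTh mE ThE
        (fun x => n%:R * (v0w m x - v0w m (thKL m) - dot g (x - thKL m)))) => x Thx.
      by apply: continuous_linearization; exact: cv.
    + rewrite (_ : [set w | _] = [set w | Num.sqrt n%:R * eps <=
          - Num.sqrt n%:R * (0 - 0 - dot g ((thETO n w : 'rV[R]_q) - thKL m))]).
        apply: (@measurable_ge_continuous_on _ _ _ _ _ _ oTh mE ThE
          (fun x => - Num.sqrt n%:R * (0 - 0 - dot g (x - thKL m)))) => x Thx.
        by apply: (@continuous_linearization _ _ (fun=> 0)); exact: cst_continuous.
      by rewrite eqEsubset; split => w; rewrite /H /= dotZr subrr sub0r mulrNN.
    (* Outside the half-space the linear term is below [eps], so the remainder must exceed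
       [t - kappaIEO - delta - eps]. *)
    + move=> w /= tw; rewrite /H /=.
      have [h|h] := leP (Num.sqrt n%:R * eps) (dot g (Num.sqrt n%:R *: ((thETO n w : 'rV[R]_q) - thKL m))).
        by right.
      left; move: h; rewrite dotZr ltr_pM2l ?sqrtr_gt0// => h.
      rewrite sE /X ler_pM2l//.
      have {}tw : t <= v0w m (thETO n w) - v0 m (wstar m) := tw.
      move: (v0w m (thETO n w)) tw h e1 => a; move: (dot _ _) (v0w m (thKL m)) => b c.
      by move: (kappaIEO m) (delta m) (v0 m _) => k D v; clear; lra.
  exact: (combine_bounds hE hX hH cmp hI).
- move=> delta00 n n0 t kt.
  have n0' : (0 : R) < n%:R by rewrite ltr0n.
  (* When [delta = 0], [thKL] also minimizes [v0w] over the open set [Theta], so the linear term is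
     zero and no splitting by [eps] is required. *)
  have vKL : v0w m (thKL m) = v0w m (thstar m).
    by move/eqP: delta00; rewrite /delta opprB addrA subrK subr_eq0 => /eqP.
  have g0 : grad (v0w m) (thKL m) = 0.
    apply: grad_argmin oTh ThKL (dv _ ThKL) _ => y Thy.
    by rewrite vKL; exact: stmin.
  have s0 : 0 < n%:R * t - n%:R * kappaIEO m by rewrite -mulrBr mulr_gt0// subr_gt0.
  have us : n%:R * t - n%:R * kappaIEO m <=
      (1 + tau1 m / tau6 m) * (n%:R * t - n%:R * kappaIEO m).
    by rewrite ler_peMl ?(ltW s0)// lerDl divr_ge0// ltW.
  have cmp : fine (PrY [set w | n%:R * t - n%:R * kappaIEO m <= GETO m (Y w)])
      - fine (PrY [set w | n%:R * t - n%:R * kappaIEO m <= GIEO m (Y w)])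
      <= - probG (n%:R * t - n%:R * kappaIEO m)
           ((1 + tau1 m / tau6 m) * (n%:R * t - n%:R * kappaIEO m)).
    exact: (gaussian_comparison hq hY sA sB t1 t6 A0 us).
  have hI := probIEO n t n0 kt.
  have hE : probR thETO n t <=
      fine (PrY [set w | n%:R * t - n%:R * kappaIEO m <= GETO m (Y w)]) + DETO n.
    have := hDETO n n0 _ s0 => /ler_normlW; rewrite lerBlDl; apply: le_trans.
    rewrite le_eqVlt; apply/orP; left; apply/eqP; congr (fine (Pr _)).
    have e w : n%:R * (v0w m (thETO n w) - v0w m (thKL m)
        - dot (grad (v0w m) (thKL m)) ((thETO n w : 'rV[R]_q) - thKL m))
        = n%:R * (v0w m (thETO n w) - v0w m (thstar m)).
      by rewrite g0 /dot mul0mx mxE subr0 vKL.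
    by apply/funext => w; rewrite /mkset (regE n)// -e.
  exact: (combine_bounds0 hE cmp hI).
split.
- apply: Dorder_cvg0 hoETO _ => n n0.
  (* The error term is nonnegative because it bounds an absolute value, here at the threshold 1. *)
  by apply: le_trans (normr_ge0 _) (hDETO n n0 1 ltr01).
- apply: Dorder_cvg0 hoIEO _ => n n0.
  by apply: le_trans (normr_ge0 _) (hDIEO n n0 1 ltr01).
- exact: Cterm_cvg0.
- by move=> eps; exact: Eterm_cvg0.
Qed.
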